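(* The system $\mathsf{RCA}_0^\omega+\mathsf{QF\text{-}AC}^{2,0}$ proves \[\mathsf{MUC}\leftrightarrow\big[(\kappa_0^3)\wedge\mathsf{WKL}\wedge\neg(\exists^2)\big]\leftrightarrow\big[(\kappa_0^3)\wedge\mathsf{WKL}\wedge\neg(S^2)\big]\leftrightarrow\big[(\kappa_0^3)\wedge\mathsf{WKL}\wedge\neg(\exists^3)\big].\]
   Context: Work in the language $\mathsf{L}_\omega$ of higher-order arithmetic with variables of all finite types: $0$ is the type of natural numbers and $\sigma\to\tau$ the type of mappings; $1=0\to0$, $2=1\to0$, $3=2\to0$. Equality at higher types is pointwise; $\le_\tau$ is defined pointwise using $\le_0$. $\mathsf{RCA}_0^\omega$ is Kohlenbach's base theory: basic axioms making $0,1,<,+,\times$ an ordered semiring, the combinators $K,S$, the recursor $\mathbf{R}_0$ ($\mathbf{R}_0(f,m,0)=m$, $\mathbf{R}_0(f,m,n+1)=f(\mathbf{R}_0(f,m,n))$), extensionality at all types, quantifier-free induction, and $\mathsf{QF\text{-}AC}^{1,0}$. $\mathsf{QF\text{-}AC}^{\sigma,\tau}$ is the schema $(\forall x^\sigma)(\exists y^\tau)A(x,y)\to(\exists Y^{\sigma\to\tau})(\forall x^\sigma)A(x,Y(x))$ for quantifier-free $A$. $\mathsf{WKL}$: every infinite binary tree has a path. $\overline{f}n=\langle f(0),\dots,f(n-1)\rangle$; $C$ is the set of $f^1\le_1 1$. A chain $A_1\leftrightarrow A_2\leftrightarrow\cdots$ means each consecutive equivalence. $(\exists^2)$: $(\exists\varphi^2\le_2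 1)(\forall f^1)\big[(\exists n^0)(f(n)=0)\leftrightarrow\varphi(f)=0\big]$. $(S^2)$: $(\exists S^2\le_2 1)(\forall f^1)\big[(\exists g^1)(\forall n^0)(f(\overline gn)=0)\leftrightarrow S(f)=0\big]$. $(\exists^3)$: $(\exists E^3\le_3 1)(\forall Y^2)\big[(\exists f^1)(Y(f)=0)\leftrightarrow E(Y)=0\big]$. $(\kappa_0^3)$: $(\exists \kappa_0^3)(\forall Y^2)\big[\kappa_0(Y)=0\leftrightarrow(\exists f\in C)(Y(f)>0)\big]$. $\mathsf{MUC}$: $(\exists\Omega^3)(\forall Y^2)(\forall f,g\in C)(\overline f\Omega(Y)=\overline g\Omega(Y)\to Y(f)=Y(g))$. *)

(* Defs.v *)
From Stdlib Require Import List.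
Import ListNotations.
Set Implicit Arguments.
Unset Strict Implicit.
Unset Printing Implicit Defensive.

Declare Scope hoa_scope.
Delimit Scope hoa_scope with hoa.
Local Open Scope hoa_scope.

Inductive ty : Set :=
| tyN : ty
| Arr : ty -> ty -> ty.

Notation "s ⟶ t" := (Arr s t) (at level 55, right associativity) : hoa_scope.
Notation ty1 := (Arr tyN tyN).
Notation ty2 := (Arr ty1 tyN).
Notation ty3 := (Arr ty2 tyN).

(** [cR] is the recursor R_0, with arguments in the order R_0(f, m, n). *)
Inductive cst : ty -> Set :=
| c0 : cst tyN
| c1 : cst tyN
| cadd : cst (tyN ⟶ tyN ⟶ tyN)
| cmul : cst (tyN ⟶ tyN ⟶ tyN)
| cK (s t : ty) : cst (s ⟶ t ⟶ s)
| cS (r s t : ty) : cst ((r ⟶ s ⟶ t) ⟶ (r ⟶ s) ⟶ r ⟶ t)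
| cR : cst (ty1 ⟶ tyN ⟶ tyN ⟶ tyN).

Definition ctx : Type := ty -> Set.

(** Syntax is well typed by construction.  A term or formula is indexed by the
    family [V] of its possible free variables ([V s] being those of type [s]);
    a quantifier over type [s] passes from [V] to [ext V s], in which [vz] is
    the bound variable and [vs] injects the older ones (de Bruijn indices). *)
Inductive ext (V : ctx) (s : ty) : ctx :=
| vz : ext V s s
| vs (t : ty) : V t -> ext V s t.

Arguments vz {V s}.
Arguments vs {V s t} _.

Definition noVar : ctx := fun _ => Empty_set.

Inductive tm (V : ctx) : ty -> Set :=
| Var (s : ty) : V s -> tm V s
| Cst (s : ty) : cst s -> tm V s
| App (s t : ty) : tm V (s ⟶ t) -> tm V s -> tm V t.

Arguments Var {V s} _.
Arguments Cst {V s} _.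
Arguments App {V s t} _ _.

(** Only equality and order at type 0 are primitive. *)
Inductive fm (V : ctx) : Set :=
| EqN : tm V tyN -> tm V tyN -> fm V
| LtN : tm V tyN -> tm V tyN -> fm V
| Bot : fm V
| And : fm V -> fm V -> fm V
| Or : fm V -> fm V -> fm V
| Imp : fm V -> fm V -> fm V
| All (s : ty) : fm (ext V s) -> fm V
| Ex (s : ty) : fm (ext V s) -> fm V.

Arguments Bot {V}.
Arguments All {V} s _.
Arguments Ex {V} s _.

Notation "f @ x" := (App f x) (at level 20, left associativity) : hoa_scope.
Notation "𝟎" := (Cst c0) : hoa_scope.
Notation "𝟏" := (Cst c1) : hoa_scope.
Notation "x ⊕ y" := (App (App (Cst cadd) x) y)
  (at level 50, left associativity) : hoa_scope.
Notation "x ⊗ y" := (App (App (Cst cmul) x) y)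
  (at level 40, left associativity) : hoa_scope.
Notation "x ≐ y" := (EqN x y) (at level 70, no associativity) : hoa_scope.
Notation "x ≺ y" := (LtN x y) (at level 70, no associativity) : hoa_scope.
Notation "A ⋏ B" := (And A B) (at level 80, right associativity) : hoa_scope.
Notation "A ⋎ B" := (Or A B) (at level 85, right associativity) : hoa_scope.
Notation "A ⇒ B" := (Imp A B) (at level 90, right associativity) : hoa_scope.
Notation "∼ A" := (Imp A Bot) (at level 35, right associativity) : hoa_scope.
Notation "A ⇔ B" := (And (Imp A B) (Imp B A))
  (at level 95, no associativity) : hoa_scope.

Notation v0 := (Var vz).
Notation v1 := (Var (vs vz)).
Notation v2 := (Var (vs (vs vz))).
Notation v3 := (Var (vs (vs (vs vz)))).

Definition liftr (V W : ctx) (s : ty) (r : forall t, V t -> W t) t (x : ext V s t) :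
    ext W s t :=
  match x with
  | vz => vz
  | vs y => vs (r _ y)
  end.

Fixpoint rent (V W : ctx) (r : forall t, V t -> W t) t (a : tm V t) : tm W t :=
  match a with
  | Var x => Var (r _ x)
  | Cst c => Cst c
  | App f b => App (rent r f) (rent r b)
  end.

Fixpoint renf (V W : ctx) (r : forall t, V t -> W t) (A : fm V) : fm W :=
  match A with
  | EqN a b => EqN (rent r a) (rent r b)
  | LtN a b => LtN (rent r a) (rent r b)
  | Bot => Bot
  | And A B => And (renf r A) (renf r B)
  | Or A B => Or (renf r A) (renf r B)
  | Imp A B => Imp (renf r A) (renf r B)
  | All s A => All s (renf (liftr (s := s) r) A)
  | Ex s A => Ex s (renf (liftr (s := s) r) A)
  end.

Definition wk V (s t : ty) (a : tm V t) : tm (ext V s) t :=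
  rent (fun _ x => vs x) a.

Definition shift V (s : ty) (A : fm V) : fm (ext V s) :=
  renf (fun _ x => vs x) A.

Arguments wk {V s t} _.
Arguments shift {V} s _.

Definition lifts (V W : ctx) (s : ty) (f : forall t, V t -> tm W t) t (x : ext V s t) :
    tm (ext W s) t :=
  match x with
  | vz => Var vz
  | vs y => wk (f _ y)
  end.

Fixpoint subt (V W : ctx) (f : forall t, V t -> tm W t) t (a : tm V t) : tm W t :=
  match a with
  | Var x => f _ x
  | Cst c => Cst c
  | App g b => App (subt f g) (subt f b)
  end.

Fixpoint subf (V W : ctx) (f : forall t, V t -> tm W t) (A : fm V) : fm W :=
  match A with
  | EqN a b => EqN (subt f a) (subt f b)
  | LtN a b => LtN (subt f a) (subt f b)
  | Bot => Bot
  | And A B => And (subf f A) (subf f B)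
  | Or A B => Or (subf f A) (subf f B)
  | Imp A B => Imp (subf f A) (subf f B)
  | All s A => All s (subf (lifts (s := s) f) A)
  | Ex s A => Ex s (subf (lifts (s := s) f) A)
  end.

(** [scons a f] sends the newest variable to [a] and the others along [f]. *)
Definition scons (V W : ctx) (s : ty) (a : tm W s) (f : forall t, V t -> tm W t) t
    (x : ext V s t) : tm W t :=
  match x in ext _ _ t return tm W s -> tm W t with
  | vz => fun a => a
  | vs y => fun _ => f _ y
  end a.

Definition inst V (s : ty) (A : fm (ext V s)) (a : tm V s) : fm V :=
  subf (scons a (fun _ x => Var x)) A.

(** The axioms of a theory may contain free variables, which are then
    implicitly universally quantified. *)
Definition theory := forall V : ctx, fm V -> Prop.

Inductive prv (T : theory) : forall {V : ctx}, list (fm V) -> fm V -> Prop :=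
| prAx V (G : list (fm V)) A : T V A -> prv T G A
| prHyp V (G : list (fm V)) A : In A G -> prv T G A
| prRAA V (G : list (fm V)) A : prv T (∼ A :: G) Bot -> prv T G A
| prAndI V (G : list (fm V)) A B : prv T G A -> prv T G B -> prv T G (A ⋏ B)
| prAndE1 V (G : list (fm V)) A B : prv T G (A ⋏ B) -> prv T G A
| prAndE2 V (G : list (fm V)) A B : prv T G (A ⋏ B) -> prv T G B
| prOrI1 V (G : list (fm V)) A B : prv T G A -> prv T G (A ⋎ B)
| prOrI2 V (G : list (fm V)) A B : prv T G B -> prv T G (A ⋎ B)
| prOrE V (G : list (fm V)) A B C :
    prv T G (A ⋎ B) -> prv T (A :: G) C -> prv T (B :: G) C -> prv T G C
| prImpI V (G : list (fm V)) A B : prv T (A :: G) B -> prv T G (A ⇒ B)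
| prImpE V (G : list (fm V)) A B : prv T G (A ⇒ B) -> prv T G A -> prv T G B
| prAllI V (G : list (fm V)) s (A : fm (ext V s)) :
    prv T (map (shift s) G) A -> prv T G (All s A)
| prAllE V (G : list (fm V)) s (A : fm (ext V s)) (a : tm V s) :
    prv T G (All s A) -> prv T G (inst A a)
| prExI V (G : list (fm V)) s (A : fm (ext V s)) (a : tm V s) :
    prv T G (inst A a) -> prv T G (Ex s A)
| prExE V (G : list (fm V)) s (A : fm (ext V s)) (B : fm V) :
    prv T G (Ex s A) -> prv T (A :: map (shift s) G) (shift s B) -> prv T G B
| prEqRefl V (G : list (fm V)) (a : tm V tyN) : prv T G (a ≐ a)
| prEqSubst V (G : list (fm V)) (A : fm (ext V tyN)) (a b : tm V tyN) :
    prv T G (a ≐ b) -> prv T G (inst A a) -> prv T G (inst A b).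

Definition proves (T : theory) (A : fm noVar) : Prop := prv T nil A.

Fixpoint eqT (s : ty) : forall V, tm V s -> tm V s -> fm V :=
  match s with
  | tyN => fun V a b => a ≐ b
  | Arr s t => fun V a b => All s (eqT (wk a @ v0) (wk b @ v0))
  end.

Fixpoint leT (s : ty) : forall V, tm V s -> tm V s -> fm V :=
  match s with
  | tyN => fun V a b => (a ≺ b) ⋎ (a ≐ b)
  | Arr s t => fun V a b => All s (leT (wk a @ v0) (wk b @ v0))
  end.

(** The bound "1" in [f <=_s 1], i.e. the constantly-one object of type [s]. *)
Fixpoint one (s : ty) V : tm V s :=
  match s with
  | tyN => 𝟏
  | Arr s t => Cst (cK t s) @ one t V
  end.
Arguments one s {V}.

Fixpoint qfree V (A : fm V) : Prop :=
  match A with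
  | EqN _ _ | LtN _ _ | Bot => True
  | And A B | Or A B | Imp A B => qfree A /\ qfree B
  | All _ _ | Ex _ _ => False
  end.

(** In [A : fm (ext (ext V s) t)] the variable [y] of type [t] is [vz] and the
    variable [x] of type [s] is [vs vz]; [A] may contain parameters from [V].
    [qfac_sub] substitutes [Y x] for [y], where [x] is now [vz] and [Y] is
    [vs vz]. *)
Definition qfac_sub V (s t : ty) :
    forall u, ext (ext V s) t u -> tm (ext (ext V (s ⟶ t)) s) u :=
  scons (v1 @ v0) (scons v0 (fun _ x => Var (vs (vs x)))).

Inductive QFAC (s t : ty) (V : ctx) : fm V -> Prop :=
| QFAC_ax (A : fm (ext (ext V s) t)) :
    qfree A ->
    QFAC s t (All s (Ex t A) ⇒
              Ex (s ⟶ t) (All s (subf (qfac_sub (V := V) (s := s) (t := t)) A))).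

Definition succ_sub V : forall u, ext V tyN u -> tm (ext V tyN) u :=
  scons (v0 ⊕ 𝟏) (fun _ x => Var (vs x)).

(** Kohlenbach's RCA_0^omega.  The basic axioms for 0, 1, <, +, * are those of
    the non-negative part of a discretely ordered ring. *)
Inductive RCA0w (V : ctx) : fm V -> Prop :=
| ax_addA (x y z : tm V tyN) : RCA0w ((x ⊕ y) ⊕ z ≐ x ⊕ (y ⊕ z))
| ax_addC (x y : tm V tyN) : RCA0w (x ⊕ y ≐ y ⊕ x)
| ax_mulA (x y z : tm V tyN) : RCA0w ((x ⊗ y) ⊗ z ≐ x ⊗ (y ⊗ z))
| ax_mulC (x y : tm V tyN) : RCA0w (x ⊗ y ≐ y ⊗ x)
| ax_mulDr (x y z : tm V tyN) : RCA0w (x ⊗ (y ⊕ z) ≐ (x ⊗ y) ⊕ (x ⊗ z))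
| ax_add0 (x : tm V tyN) : RCA0w (x ⊕ 𝟎 ≐ x)
| ax_mul0 (x : tm V tyN) : RCA0w (x ⊗ 𝟎 ≐ 𝟎)
| ax_mul1 (x : tm V tyN) : RCA0w (x ⊗ 𝟏 ≐ x)
| ax_lt_irr (x : tm V tyN) : RCA0w (∼ (x ≺ x))
| ax_lt_trans (x y z : tm V tyN) : RCA0w (x ≺ y ⋏ y ≺ z ⇒ x ≺ z)
| ax_lt_total (x y : tm V tyN) : RCA0w (x ≺ y ⋎ x ≐ y ⋎ y ≺ x)
| ax_lt_add (x y z : tm V tyN) : RCA0w (x ≺ y ⇒ x ⊕ z ≺ y ⊕ z)
| ax_lt_mul (x y z : tm V tyN) : RCA0w (𝟎 ≺ z ⋏ x ≺ y ⇒ x ⊗ z ≺ y ⊗ z)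
| ax_lt_sub (x y : tm V tyN) : RCA0w (x ≺ y ⇒ Ex tyN (wk x ⊕ v0 ≐ wk y))
| ax_lt01 : RCA0w (𝟎 ≺ 𝟏)
| ax_discrete (x : tm V tyN) : RCA0w (𝟎 ≺ x ⇒ leT 𝟏 x)
| ax_le0 (x : tm V tyN) : RCA0w (leT 𝟎 x)
| ax_K s t (x : tm V s) (y : tm V t) : RCA0w (eqT (Cst (cK s t) @ x @ y) x)
| ax_S r s t (x : tm V (r ⟶ s ⟶ t)) (y : tm V (r ⟶ s)) (z : tm V r) :
    RCA0w (eqT (Cst (cS r s t) @ x @ y @ z) (x @ z @ (y @ z)))
| ax_R0 (f : tm V ty1) (m : tm V tyN) : RCA0w (Cst cR @ f @ m @ 𝟎 ≐ m)
| ax_RS (f : tm V ty1) (m n : tm V tyN) :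
    RCA0w (Cst cR @ f @ m @ (n ⊕ 𝟏) ≐ f @ (Cst cR @ f @ m @ n))
| ax_ext s t (f : tm V (s ⟶ t)) (x y : tm V s) :
    RCA0w (eqT x y ⇒ eqT (f @ x) (f @ y))
| ax_ind (A : fm (ext V tyN)) :
    qfree A ->
    RCA0w (inst A 𝟎 ⋏ All tyN (A ⇒ subf (@succ_sub V) A) ⇒ All tyN A)
| ax_QFAC10 (A : fm V) : QFAC ty1 tyN A -> RCA0w A.

Definition extend (T U : theory) : theory := fun V A => T V A \/ U V A.

(** Sequences are coded by numbers: the empty sequence has code 0, and
    [(s + a)^2 + s + 1] codes the extension of the sequence coded by [s] with
    the entry [a]; [(s, a) |-> (s + a)^2 + s] is injective. *)
Definition snoc V (s a : tm V tyN) : tm V tyN :=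
  ((s ⊕ a) ⊗ (s ⊕ a)) ⊕ s ⊕ 𝟏.

(** [initseg f n s] says that [s] is the code of [<f(0), ..., f(n-1)>]: some
    [h] (here the variable of type 1) lists the codes of the successive initial
    segments up to length [n]. *)
Definition initseg V (f : tm V ty1) (n s : tm V tyN) : fm V :=
  Ex ty1
    (v0 @ 𝟎 ≐ 𝟎
     ⋏ All tyN (v0 ≺ wk (wk n) ⇒
                v1 @ (v0 ⊕ 𝟏) ≐ snoc (v1 @ v0) (wk (wk f) @ v0))
     ⋏ v0 @ wk n ≐ wk s).

(** [f(<g(0), ..., g(n-1)>) = 0] *)
Definition zero_at_seg V (f g : tm V ty1) (n : tm V tyN) : fm V :=
  Ex tyN (initseg (wk g) (wk n) v0 ⋏ wk f @ v0 ≐ 𝟎).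

Definition eq_seg V (f g : tm V ty1) (n : tm V tyN) : fm V :=
  Ex tyN (initseg (wk f) (wk n) v0 ⋏ initseg (wk g) (wk n) v0).

Definition AllC V (A : fm (ext V ty1)) : fm V := All ty1 (leT v0 (one ty1) ⇒ A).
Definition ExC V (A : fm (ext V ty1)) : fm V := Ex ty1 (leT v0 (one ty1) ⋏ A).

(** A set [T] of (codes of) finite sequences is given by a function of type 1,
    [s] being an element when [T(s) = 0].  Every finite binary sequence is an
    initial segment of some [g] in [C]. *)
Definition bin_tree V (T : tm V ty1) : fm V :=
  All tyN (wk T @ v0 ≐ 𝟎 ⇒ ExC (Ex tyN (initseg v1 v0 v2)))
  ⋏ All ty1 (All tyN (All tyN
      (v0 ≺ v1 ⋏ zero_at_seg (wk (wk (wk T))) v2 v1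
       ⇒ zero_at_seg (wk (wk (wk T))) v2 v0))).

Definition infinite_set V (T : tm V ty1) : fm V :=
  All tyN (Ex tyN (v1 ≺ v0 ⋏ wk (wk T) @ v0 ≐ 𝟎)).

Definition WKL V : fm V :=
  All ty1 (bin_tree v0 ⋏ infinite_set v0 ⇒ ExC (All tyN (zero_at_seg v2 v1 v0))).

Definition E2 V : fm V :=
  Ex ty2 (leT v0 (one ty2)
          ⋏ All ty1 (Ex tyN (v1 @ v0 ≐ 𝟎) ⇔ v1 @ v0 ≐ 𝟎)).

Definition S2 V : fm V :=
  Ex ty2 (leT v0 (one ty2)
          ⋏ All ty1 (Ex ty1 (All tyN (zero_at_seg v2 v1 v0)) ⇔ v1 @ v0 ≐ 𝟎)).

Definition E3 V : fm V :=
  Ex ty3 (leT v0 (one ty3)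
          ⋏ All ty2 (Ex ty1 (v1 @ v0 ≐ 𝟎) ⇔ v1 @ v0 ≐ 𝟎)).

Definition kappa03 V : fm V :=
  Ex ty3 (All ty2 (v1 @ v0 ≐ 𝟎 ⇔ ExC (𝟎 ≺ v1 @ v0))).

(** In the body, [v3] is Omega, [v2] is Y, [v1] is f and [v0] is g. *)
Definition MUC V : fm V :=
  Ex ty3 (All ty2 (AllC (AllC
    (eq_seg v1 v0 (v3 @ v2) ⇒ v2 @ v1 ≐ v2 @ v0)))).

Arguments WKL {V}.
Arguments E2 {V}.
Arguments S2 {V}.
Arguments E3 {V}.
Arguments kappa03 {V}.
Arguments MUC {V}.

(* Main.v *)
(** By completeness of the calculus it suffices to prove the equivalences in every
    model; the extensional collapse of a Henkin term model interprets equality of every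
    type by identity, so that one may reason classically about actual functionals that
    are closed under S, K, recursion and QF-AC.

    In such a model, MUC bounds every [Y] of type 2 on [C]: take moduli of [Y] and of
    [f |-> f (Y f)]; if [Y f] exceeded both, flipping [f] at the position [Y f] would not
    change [Y f], yet would change [f (Y f)].  Hence a binary tree without a path is
    finite, which is WKL, and the index of an approximation of [f] in a dense sequence of
    [C] is bounded, which turns the quantifier of kappa_0 into a bounded search.
    Conversely, if some [Y] has no modulus on [C], then [exists k, x k = 0] holds iff some
    pair in [C] is separated by [Y] and has a difference at a position that bounds a zero
    of [x]; so kappa_0 yields (exists^2), contrary to its negation.  Given kappa_0, the
    principles (exists^2), (S^2) and (exists^3) are equivalent since Baire space is an
    image of [C] under a functional definable from (exists^2). *)
From Stdlib Require Import List Arith Lia Ring Eqdep_dec Cantor.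
From Stdlib Require Import ClassicalEpsilon PropExtensionality FunctionalExtensionality.
From Stdlib Require Import ssreflect.
Require Import Defs.
Import ListNotations.
Local Open Scope hoa_scope.

Set Implicit Arguments.
Unset Strict Implicit.
Unset Printing Implicit Defensive.
Set SsrOldRewriteGoalsOrder.

(** * Substitution *)

Definition ren (V W : ctx) : Type := forall t, V t -> W t.
Definition sub (V W : ctx) : Type := forall t, V t -> tm W t.
Definition ids (V : ctx) : sub V V := fun t x => Var x.
Definition comps (U V W : ctx) (f : sub U V) (g : sub V W) : sub U W :=
  fun t x => subt g (f t x).

Lemma subt_ext V W (f g : sub V W) t (a : tm V t) :
  (forall s x, f s x = g s x) -> subt f a = subt g a.
Proof. by move=> E; elim: a => //= s u a -> b ->. Qed.

Lemma lifts_ext V W (f g : sub V W) s :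
  (forall t x, f t x = g t x) ->
  forall t (x : ext V s t), lifts f x = lifts g x.
Proof. by move=> E t [|u x] //=; rewrite E. Qed.

Lemma subf_ext V (A : fm V) :
  forall W (f g : sub V W), (forall s x, f s x = g s x) -> subf f A = subf g A.
Proof.
elim: A => {V}.
- by move=> V a b W f g E /=; rewrite !(subt_ext _ E).
- by move=> V a b W f g E /=; rewrite !(subt_ext _ E).
- by [].
- by move=> V A HA B HB W f g E /=; rewrite (HA _ _ _ E) (HB _ _ _ E).
- by move=> V A HA B HB W f g E /=; rewrite (HA _ _ _ E) (HB _ _ _ E).
- by move=> V A HA B HB W f g E /=; rewrite (HA _ _ _ E) (HB _ _ _ E).
- by move=> V s A HA W f g E /=; rewrite (HA _ _ _ (lifts_ext E)).
- by move=> V s A HA W f g E /=; rewrite (HA _ _ _ (lifts_ext E)).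
Qed.

Lemma rent_subt V W (r : ren V W) t (a : tm V t) :
  rent r a = subt (fun s x => Var (r s x)) a.
Proof. by elim: a => //= s u a -> b ->. Qed.

Lemma renf_subf V (A : fm V) :
  forall W (r : ren V W), renf r A = subf (fun s x => Var (r s x)) A.
Proof.
have L : forall V W (r : ren V W) s t (x : ext V s t),
    Var (liftr r x) = lifts (fun s x => Var (r s x)) x by move=> ? ? ? ? ? [].
elim: A => {V} /=.
- by move=> V a b W r; rewrite !rent_subt.
- by move=> V a b W r; rewrite !rent_subt.
- by [].
- by move=> V A HA B HB W r; rewrite HA HB.
- by move=> V A HA B HB W r; rewrite HA HB.
- by move=> V A HA B HB W r; rewrite HA HB.
- by move=> V s A HA W r; rewrite HA (subf_ext _ (L V W r s)).
- by move=> V s A HA W r; rewrite HA (subf_ext _ (L V W r s)).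
Qed.

Lemma wk_subt V s t (a : tm V t) : wk (s := s) a = subt (fun u x => Var (vs x)) a.
Proof. exact: rent_subt. Qed.

Lemma subt_subt U V W (f : sub U V) (g : sub V W) t (a : tm U t) :
  subt g (subt f a) = subt (comps f g) a.
Proof. by elim: a => //= s u a -> b ->. Qed.

Lemma subt_wk V W (f : sub V W) s t (a : tm V t) :
  subt (lifts (s := s) f) (wk a) = wk (subt f a).
Proof. by rewrite !wk_subt !subt_subt; apply: subt_ext => u x; rewrite /comps /= -wk_subt. Qed.

Lemma subt_scons_wk V W (f : sub V W) s (b : tm W s) t (a : tm V t) :
  subt (scons b f) (wk a) = subt f a.
Proof. by rewrite wk_subt subt_subt; apply: subt_ext. Qed.

Lemma lifts_comps U V W (f : sub U V) (g : sub V W) s t (x : ext U s t) :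
  comps (lifts (s := s) f) (lifts g) x = lifts (comps f g) x.
Proof. by case: x => //= u x; rewrite /comps /= subt_wk. Qed.

Lemma subf_subf U (A : fm U) :
  forall V W (f : sub U V) (g : sub V W), subf g (subf f A) = subf (comps f g) A.
Proof.
elim: A => {U} /=.
- by move=> U a b V W f g; rewrite !subt_subt.
- by move=> U a b V W f g; rewrite !subt_subt.
- by [].
- by move=> U A HA B HB V W f g; rewrite HA HB.
- by move=> U A HA B HB V W f g; rewrite HA HB.
- by move=> U A HA B HB V W f g; rewrite HA HB.
- by move=> U s A HA V W f g; rewrite HA (subf_ext _ (@lifts_comps _ _ _ f g s)).
- by move=> U s A HA V W f g; rewrite HA (subf_ext _ (@lifts_comps _ _ _ f g s)).
Qed.

Lemma subt_ids V t (a : tm V t) : subt (@ids V) a = a.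
Proof. by elim: a => //= s u a -> b ->. Qed.

Lemma subf_ids V (A : fm V) : subf (@ids V) A = A.
Proof.
have L : forall V s t (x : ext V s t), lifts (s := s) (@ids V) x = @ids _ _ x
  by move=> ? ? ? [].
elim: A => {V} /=.
- by move=> V a b; rewrite !subt_ids.
- by move=> V a b; rewrite !subt_ids.
- by [].
- by move=> V A -> B ->.
- by move=> V A -> B ->.
- by move=> V A -> B ->.
- by move=> V s A {2}<-; rewrite (subf_ext _ (L V s)).
- by move=> V s A {2}<-; rewrite (subf_ext _ (L V s)).
Qed.

Lemma subf_inst V W (f : sub V W) s (A : fm (ext V s)) (a : tm V s) :
  subf f (inst A a) = inst (subf (lifts f) A) (subt f a).
Proof.
rewrite /inst !subf_subf; apply: subf_ext => t [|u x] //=.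
by rewrite /comps /= subt_scons_wk subt_ids.
Qed.

Lemma inst_lifts V W (f : sub V W) s (A : fm (ext V s)) (a : tm W s) :
  inst (subf (lifts f) A) a = subf (scons a f) A.
Proof.
rewrite /inst subf_subf; apply: subf_ext => t [|u x] //=.
by rewrite /comps /= subt_scons_wk subt_ids.
Qed.

Lemma shift_subf V s (A : fm V) : shift s A = subf (fun t x => Var (vs x)) A.
Proof. exact: renf_subf. Qed.

Lemma subf_shift V W (f : sub V W) s (A : fm V) :
  subf (lifts f) (shift s A) = shift s (subf f A).
Proof.
rewrite !shift_subf !subf_subf; apply: subf_ext => t x.
by rewrite /comps /= wk_subt.
Qed.

Lemma subf_eqT V W (f : sub V W) s (a b : tm V s) :
  subf f (eqT a b) = eqT (subt f a) (subt f b).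
Proof. by elim: s V W f a b => //= s _ t IH V W f a b; rewrite IH /= !subt_wk. Qed.

Lemma subf_leT V W (f : sub V W) s (a b : tm V s) :
  subf f (leT a b) = leT (subt f a) (subt f b).
Proof. by elim: s V W f a b => //= s _ t IH V W f a b; rewrite IH /= !subt_wk. Qed.

Lemma subf_qfree V (A : fm V) : forall W (f : sub V W), qfree A -> qfree (subf f A).
Proof.
by elim: A => {V} //= V A HA B HB W f [qA qB]; split; [apply: HA|apply: HB|apply: HA|apply: HB|apply: HA|apply: HB].
Qed.

(** This makes provability stable under substitution, by which the completeness proof abstracts a
    fresh constant to a bound variable and removes the constants again. *)
Definition subst_closed (T : theory) : Prop :=
  forall V W (f : sub V W) A, T V A -> T W (subf f A).

Lemma QFAC_subst s t : subst_closed (QFAC s t).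
Proof.
move=> V W f _ [A qA] /=.
(* Substituting for the parameters commutes with replacing [y] by [Y x], so an instance of choice
   goes to an instance of choice. *)
have -> : subf (lifts (lifts f)) (subf (@qfac_sub V s t) A) =
          subf (@qfac_sub W s t) (subf (lifts (lifts f)) A).
  rewrite !subf_subf; apply: subf_ext => u [|v [|w x]] //=.
  rewrite /comps /= !wk_subt !subt_subt; apply: subt_ext => ? y //=.
exact: QFAC_ax (subf_qfree _ qA).
Qed.

Lemma RCA0w_subst : subst_closed RCA0w.
Proof.
move=> V W f _ []; intros; rewrite /= ?subf_eqT ?subf_leT ?subt_wk /=;
  try by constructor.
- have -> : subf (lifts f) (subf (@succ_sub V) A) =
            subf (@succ_sub W) (subf (lifts f) A).
    rewrite !subf_subf; apply: subf_ext => u [|v x] //=.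
    by rewrite /comps /= subt_scons_wk wk_subt.
  rewrite subf_inst; apply: ax_ind; exact: subf_qfree.
- by apply: ax_QFAC10; apply: QFAC_subst.
Qed.

Lemma extend_subst T U : subst_closed T -> subst_closed U -> subst_closed (extend T U).
Proof. by move=> hT hU V W f A [H|H]; [left; apply: hT|right; apply: hU]. Qed.

(** * Structural rules *)

Lemma prv_weak T V (G : list (fm V)) A :
  prv T G A -> forall G', incl G G' -> prv T G' A.
Proof.
have H0 : forall V (G G' : list (fm V)) A, incl G G' -> incl (A :: G) (A :: G').
  by move=> ? G0 G' B I C [<-|H]; [left|right; apply: I].
elim=> {V G A}.
- by move=> *; apply: prAx.
- by move=> V G A H G' I; apply/prHyp/I.
- by move=> V G A _ IH G' I; apply/prRAA/IH/H0.
- by move=> V G A B _ IA _ IB G' I; apply: prAndI; auto.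
- by move=> V G A B _ IA G' I; apply: (prAndE1 (B := B)); auto.
- by move=> V G A B _ IA G' I; apply: (prAndE2 (A := A)); auto.
- by move=> V G A B _ IA G' I; apply: prOrI1; auto.
- by move=> V G A B _ IA G' I; apply: prOrI2; auto.
- by move=> V G A B C _ I1 _ I2 _ I3 G' I; apply: prOrE (I1 _ I) (I2 _ _) (I3 _ _); auto.
- by move=> V G A B _ IH G' I; apply/prImpI/IH/H0.
- by move=> V G A B _ I1 _ I2 G' I; apply: prImpE (I1 _ I) (I2 _ I).
- by move=> V G s A _ IH G' I; apply/prAllI/IH/incl_map.
- by move=> V G s A a _ IH G' I; apply/prAllE/IH.
- by move=> V G s A a _ IH G' I; apply/prExI/IH.
- move=> V G s A B _ I1 _ I2 G' I; apply: prExE (I1 _ I) (I2 _ _).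
  by apply/H0/incl_map.
- by move=> *; apply: prEqRefl.
- by move=> V G A a b _ I1 _ I2 G' I; apply: prEqSubst (I1 _ I) (I2 _ I).
Qed.

Lemma map_shift_subf V W (f : sub V W) s (G : list (fm V)) :
  map (subf (lifts f)) (map (shift s) G) = map (shift s) (map (subf f) G).
Proof. by rewrite !map_map; apply: map_ext => A; rewrite subf_shift. Qed.

Lemma prv_subst T V (G : list (fm V)) A : subst_closed T ->
  prv T G A -> forall W (f : sub V W), prv T (map (subf f) G) (subf f A).
Proof.
move=> cT; elim=> {V G A}.
- by move=> V G A H W f; apply/prAx/cT.
- by move=> V G A H W f; apply/prHyp/in_map.
- by move=> V G A _ IH W f; apply: prRAA; apply: IH.
- by move=> V G A B _ IA _ IB W f; apply: prAndI; [apply: IA|apply: IB].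
- by move=> V G A B _ IA W f; apply: prAndE1 (IA _ _).
- by move=> V G A B _ IA W f; apply: prAndE2 (IA _ _).
- by move=> V G A B _ IA W f; apply: prOrI1 (IA _ _).
- by move=> V G A B _ IA W f; apply: prOrI2 (IA _ _).
- by move=> V G A B C _ I1 _ I2 _ I3 W f; apply: prOrE (I1 _ _) (I2 _ _) (I3 _ _).
- by move=> V G A B _ IH W f; apply: prImpI; apply: IH.
- by move=> V G A B _ I1 _ I2 W f; apply: prImpE (I1 _ _) (I2 _ _).
- by move=> V G s A _ IH W f; apply: prAllI; rewrite -map_shift_subf; apply: IH.
- by move=> V G s A a _ IH W f; rewrite subf_inst; apply: prAllE; apply: IH.
- by move=> V G s A a _ IH W f; apply: (prExI (a := subt f a)); rewrite -subf_inst; apply: IH.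
- move=> V G s A B _ I1 _ I2 W f; apply: prExE (I1 _ _) _.
  by rewrite -map_shift_subf -subf_shift; apply: I2.
- by move=> *; apply: prEqRefl.
- move=> V G A a b _ I1 _ I2 W f; rewrite subf_inst; apply: prEqSubst (I1 _ _) _.
  by rewrite -subf_inst; apply: I2.
Qed.

(** * Countability of formulas *)

Definition pr (a b : nat) : nat := to_nat (a, b).

Lemma pr_inj a b c d : pr a b = pr c d -> a = c /\ b = d.
Proof. by move=> /to_nat_inj [-> ->]. Qed.

Definition ty_eq_dec (s t : ty) : {s = t} + {s <> t}.
Proof. decide equality. Defined.

Lemma existT_ty_inj (P : ty -> Type) s (x y : P s) : existT P s x = existT P s y -> x = y.
Proof. exact: (inj_pair2_eq_dec _ ty_eq_dec). Qed.

Fixpoint code_ty (s : ty) : nat :=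
  match s with tyN => 0 | Arr s t => S (pr (code_ty s) (code_ty t)) end.

Lemma code_ty_inj s t : code_ty s = code_ty t -> s = t.
Proof.
elim: s t => [|s Hs u Hu] [|s' u'] //= [/pr_inj [E1 E2]].
by rewrite (Hs _ E1) (Hu _ E2).
Qed.

Definition code_cst s (c : cst s) : nat :=
  match c with
  | c0 => pr 0 0 | c1 => pr 1 0 | cadd => pr 2 0 | cmul => pr 3 0
  | cK s t => pr 4 (pr (code_ty s) (code_ty t))
  | cS r s t => pr 5 (pr (code_ty r) (pr (code_ty s) (code_ty t)))
  | cR => pr 6 0
  end.

Lemma code_cst_inj s t (c : cst s) (d : cst t) :
  code_cst c = code_cst d -> existT cst s c = existT cst t d.
Proof.
case: c => [||||a b|a b e|]; case: d => [||||a' b'|a' b' e'|] /= => /pr_inj [] //.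
- by move=> _ /pr_inj [/code_ty_inj -> /code_ty_inj ->].
- by move=> _ /pr_inj [/code_ty_inj -> /pr_inj [/code_ty_inj -> /code_ty_inj ->]].
Qed.

Definition var_code (V : ctx) : Type := forall s, V s -> nat.

Definition var_inj V (h : var_code V) : Prop := forall s (x y : V s), h s x = h s y -> x = y.

Definition ext_code V (h : var_code V) s : var_code (ext V s) :=
  fun t x => match x with vz => 0 | vs y => S (h _ y) end.

Lemma ext_code_inj V (h : var_code V) s : var_inj h -> var_inj (@ext_code V h s).
Proof.
move=> hi t x y.
(* Equality of dependent pairs lets the types of the two variables differ during the case
   analysis. *)
have : ext_code h x = ext_code h y -> existT (ext V s) t x = existT (ext V s) t y.
  case: x y => [|t' x] y; last by case: y x => //= t'' y x [/hi ->].
  have Z : forall u (z : ext V s u), ext_code h z = 0 ->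
      existT (ext V s) s vz = existT (ext V s) u z by move=> u [].
  by move=> /(@eq_sym _ _ _) /Z.
by move=> H /H; apply: existT_ty_inj.
Qed.

(** A variable is coded without its type, which the type of the term determines; an application
    records the type of its argument, which is not visible from outside. *)
Fixpoint code_tm V (h : var_code V) s (a : tm V s) : nat :=
  match a with
  | @Var _ s x => pr 0 (h s x)
  | Cst c => pr 1 (code_cst c)
  | @App _ s _ f b => pr 2 (pr (code_ty s) (pr (code_tm h f) (code_tm h b)))
  end.

Lemma code_tm_inj V (h : var_code V) s (a b : tm V s) :
  var_inj h -> code_tm h a = code_tm h b -> a = b.
Proof.
move=> hi; elim: a b => [{}s x|{}s c|{}s t f Hf x Hx] b.
- by case: b x => [u y|u d|u v g y] x /= /pr_inj [] // _ /hi ->.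
- case: b c => [u y|u d|u v g y] c /= /pr_inj [] // _ /code_cst_inj E.
  by rewrite (existT_ty_inj E).
- case: b f Hf => [u y|u d|u v g y] f Hf /= /pr_inj [] // _.
  by move=> /pr_inj [/code_ty_inj E]; subst u => /pr_inj [/Hf -> /Hx ->].
Qed.

Fixpoint code_fm V (h : var_code V) (A : fm V) : nat :=
  match A with
  | EqN a b => pr 0 (pr (code_tm h a) (code_tm h b))
  | LtN a b => pr 1 (pr (code_tm h a) (code_tm h b))
  | Bot => pr 2 0
  | And A B => pr 3 (pr (code_fm h A) (code_fm h B))
  | Or A B => pr 4 (pr (code_fm h A) (code_fm h B))
  | Imp A B => pr 5 (pr (code_fm h A) (code_fm h B))
  | All s A => pr 6 (pr (code_ty s) (code_fm (ext_code h (s := s)) A))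
  | Ex s A => pr 7 (pr (code_ty s) (code_fm (ext_code h (s := s)) A))
  end.

(** Injectivity means that stage [n] of the Henkin construction has at most one formula to treat,
    the one with code [n]. *)
Lemma code_fm_inj V (A : fm V) :
  forall h : var_code V, var_inj h -> forall B, code_fm h A = code_fm h B -> A = B.
Proof.
elim: A => {V}.
- by move=> V a b h hi [a' b'|a' b'||A' B'|A' B'|A' B'|u A'|u A'] /= /pr_inj [] // _ /pr_inj [/(code_tm_inj hi) -> /(code_tm_inj hi) ->].
- by move=> V a b h hi [a' b'|a' b'||A' B'|A' B'|A' B'|u A'|u A'] /= /pr_inj [] // _ /pr_inj [/(code_tm_inj hi) -> /(code_tm_inj hi) ->].
- by move=> V h hi [a' b'|a' b'||A' B'|A' B'|A' B'|u A'|u A'] /= /pr_inj [].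
- by move=> V A HA B HB h hi [a' b'|a' b'||A' B'|A' B'|A' B'|u A'|u A'] /= /pr_inj [] // _ /pr_inj [/(HA _ hi) -> /(HB _ hi) ->].
- by move=> V A HA B HB h hi [a' b'|a' b'||A' B'|A' B'|A' B'|u A'|u A'] /= /pr_inj [] // _ /pr_inj [/(HA _ hi) -> /(HB _ hi) ->].
- by move=> V A HA B HB h hi [a' b'|a' b'||A' B'|A' B'|A' B'|u A'|u A'] /= /pr_inj [] // _ /pr_inj [/(HA _ hi) -> /(HB _ hi) ->].
- move=> V s A HA h hi [a' b'|a' b'||A' B'|A' B'|A' B'|u A'|u A'] /= /pr_inj [] // _ /pr_inj [/code_ty_inj E]; subst u.
  by move=> /(HA _ (ext_code_inj hi)) ->.
- move=> V s A HA h hi [a' b'|a' b'||A' B'|A' B'|A' B'|u A'|u A'] /= /pr_inj [] // _ /pr_inj [/code_ty_inj E]; subst u.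
  by move=> /(HA _ (ext_code_inj hi)) ->.
Qed.

(** * Freshness *)

Definition lift_pred (V : ctx) (P : forall s, V s -> Prop) s t (x : ext V s t) : Prop :=
  match x with vz => True | vs y => P _ y end.

Fixpoint free_tm (V : ctx) (P : forall s, V s -> Prop) s (a : tm V s) : Prop :=
  match a with
  | Var x => P _ x
  | Cst _ => True
  | App f b => free_tm P f /\ free_tm P b
  end.

(** With [P] a strict bound on names, this expresses that every name from the bound on is fresh for
    the formula. *)
Fixpoint free_in (V : ctx) (P : forall s, V s -> Prop) (A : fm V) : Prop :=
  match A with
  | EqN a b | LtN a b => free_tm P a /\ free_tm P b
  | Bot => True
  | And A B | Or A B | Imp A B => free_in P A /\ free_in P B
  | All s A | Ex s A => free_in (lift_pred P (s := s)) A
  end.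

Lemma free_tm_mono (V : ctx) (P Q : forall s, V s -> Prop) s (a : tm V s) :
  (forall t x, P t x -> Q t x) -> free_tm P a -> free_tm Q a.
Proof. by move=> H; elim: a => /= [u x /H|//|u v f Hf b Hb [/Hf ? /Hb ?]]. Qed.

Lemma free_in_mono V (A : fm V) : forall P Q : forall s, V s -> Prop,
  (forall t x, P t x -> Q t x) -> free_in P A -> free_in Q A.
Proof.
have L : forall (V : ctx) (P Q : forall s, V s -> Prop) s, (forall t x, P t x -> Q t x) ->
    forall t (x : ext V s t), lift_pred P x -> lift_pred Q x.
  by move=> ? P Q s H t [] //= u x; apply: H.
elim: A => {V} //=.
- by move=> V a b P Q H [/(free_tm_mono H) ? /(free_tm_mono H)].
- by move=> V a b P Q H [/(free_tm_mono H) ? /(free_tm_mono H)].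
- by move=> V A HA B HB P Q H [/(HA _ _ H) ? /(HB _ _ H)].
- by move=> V A HA B HB P Q H [/(HA _ _ H) ? /(HB _ _ H)].
- by move=> V A HA B HB P Q H [/(HA _ _ H) ? /(HB _ _ H)].
- by move=> V s A HA P Q H; apply/HA/L.
- by move=> V s A HA P Q H; apply/HA/L.
Qed.

Lemma free_tm_bound V (h : var_code V) s (a : tm V s) :
  exists n, free_tm (fun t x => h t x < n) a.
Proof.
elim: a => [u x|u c|u v f [n Hn] b [m Hm]] /=.
- by exists (S (h u x)); lia.
- by exists 0.
- exists (n + m); split; [move: Hn|move: Hm]; apply: free_tm_mono => t x; lia.
Qed.

Lemma free_in_bound V (A : fm V) :
  forall h : var_code V, exists n, free_in (fun t x => h t x < n) A.
Proof.
have B : forall V (h : var_code V) (A B : fm V),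
   (forall h : var_code V, exists n, free_in (fun t x => h t x < n) A) ->
   (forall h : var_code V, exists n, free_in (fun t x => h t x < n) B) ->
   exists n, free_in (fun t x => h t x < n) A /\ free_in (fun t x => h t x < n) B.
  move=> ? h A0 B /(_ h) [n Hn] /(_ h) [m Hm]; exists (n + m); split;
    [move: Hn|move: Hm]; apply: free_in_mono => t x; lia.
have Q : forall V (h : var_code V) s (A : fm (ext V s)),
   (forall h : var_code (ext V s), exists n, free_in (fun t x => h t x < n) A) ->
   exists n, free_in (lift_pred (fun t x => h t x < n) (s := s)) A.
  move=> ? h s A0 /(_ (ext_code h (s := s))) [n Hn]; exists n; move: Hn.
  by apply: free_in_mono => t [] //= u x; lia.
elim: A => {V} /=; auto.
- move=> V a b h; have [n Hn] := free_tm_bound h a; have [m Hm] := free_tm_bound h b.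
  exists (n + m); split; [move: Hn|move: Hm]; apply: free_tm_mono => t x; lia.
- move=> V a b h; have [n Hn] := free_tm_bound h a; have [m Hm] := free_tm_bound h b.
  exists (n + m); split; [move: Hn|move: Hm]; apply: free_tm_mono => t x; lia.
- by move=> V h; exists 0.
Qed.

Lemma subt_free (V : ctx) (P : forall s, V s -> Prop) W (f g : sub V W) s (a : tm V s) :
  (forall t x, P t x -> f t x = g t x) -> free_tm P a -> subt f a = subt g a.
Proof. by move=> E; elim: a => //= u v a Ha b Hb [/Ha -> /Hb ->]. Qed.

Lemma subf_free V (A : fm V) : forall (P : forall s, V s -> Prop) W (f g : sub V W),
  (forall t x, P t x -> f t x = g t x) -> free_in P A -> subf f A = subf g A.
Proof.
have L : forall (V : ctx) (P : forall s, V s -> Prop) W (f g : sub V W) s,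
    (forall t x, P t x -> f t x = g t x) ->
    forall t (x : ext V s t), lift_pred P x -> lifts f x = lifts g x.
  by move=> ? P W f g s E t [] //= u x /E ->.
elim: A => {V} //=.
- by move=> V a b P W f g E [/(subt_free E) -> /(subt_free E) ->].
- by move=> V a b P W f g E [/(subt_free E) -> /(subt_free E) ->].
- by move=> V A HA B HB P W f g E [/(HA _ _ _ _ E) -> /(HB _ _ _ _ E) ->].
- by move=> V A HA B HB P W f g E [/(HA _ _ _ _ E) -> /(HB _ _ _ _ E) ->].
- by move=> V A HA B HB P W f g E [/(HA _ _ _ _ E) -> /(HB _ _ _ _ E) ->].
- by move=> V s A HA P W f g E F; rewrite (HA _ _ _ _ (L _ _ _ _ _ _ E) F).
- by move=> V s A HA P W f g E F; rewrite (HA _ _ _ _ (L _ _ _ _ _ _ E) F).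
Qed.

(** * Henkin models *)

Record structure := Structure {
  dom : ty -> Set;
  app : forall s t, dom (s ⟶ t) -> dom s -> dom t;
  int_cst : forall s, cst s -> dom s;
  lt : dom tyN -> dom tyN -> Prop }.

Arguments app {M s t} : rename.
Arguments int_cst {M s} : rename.
Arguments lt {M} : rename.

Definition env (M : structure) (V : ctx) : Type := forall s, V s -> dom M s.

Definition econs M (V : ctx) s (d : dom M s) (e : env M V) : env M (ext V s) :=
  fun t x => match x in ext _ _ t return dom M s -> dom M t with
             | vz => fun d => d
             | vs y => fun _ => e _ y
             end d.

Fixpoint ev M V (e : env M V) s (a : tm V s) : dom M s :=
  match a with
  | Var x => e _ x
  | Cst c => int_cst c
  | App f b => app (ev e f) (ev e b)
  end.

Fixpoint sat M V (e : env M V) (A : fm V) : Prop :=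
  match A with
  | EqN a b => ev e a = ev e b
  | LtN a b => lt (ev e a) (ev e b)
  | Bot => False
  | And A B => sat e A /\ sat e B
  | Or A B => sat e A \/ sat e B
  | Imp A B => sat e A -> sat e B
  | All s A => forall d, sat (econs d e) A
  | Ex s A => exists d : dom M s, sat (econs d e) A
  end.

Lemma ev_ext M V (e e' : env M V) s (a : tm V s) :
  (forall t x, e t x = e' t x) -> ev e a = ev e' a.
Proof. by move=> E; elim: a => //= u v f -> b ->. Qed.

Lemma sat_ext M V (A : fm V) :
  forall e e' : env M V, (forall t x, e t x = e' t x) -> sat e A <-> sat e' A.
Proof.
have L : forall V (e e' : env M V) s (d : dom M s), (forall t x, e t x = e' t x) ->
    forall t (x : ext V s t), econs d e x = econs d e' x.
  by move=> ? e e' s d E t [] //= u x.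
elim: A => {V} /=.
- by move=> V a b e e' E; rewrite !(ev_ext _ E).
- by move=> V a b e e' E; rewrite !(ev_ext _ E).
- by [].
- by move=> V A HA B HB e e' E; rewrite (HA _ _ E) (HB _ _ E).
- by move=> V A HA B HB e e' E; rewrite (HA _ _ E) (HB _ _ E).
- by move=> V A HA B HB e e' E; rewrite (HA _ _ E) (HB _ _ E).
- by move=> V s A HA e e' E; split=> H d; move: (H d); rewrite (HA _ _ (L _ _ _ _ d E)).
- by move=> V s A HA e e' E; split=> - [d H]; exists d; move: H; rewrite (HA _ _ (L _ _ _ _ d E)).
Qed.

Definition extensional (M : structure) : Prop :=
  forall s t (f g : dom M (s ⟶ t)), (forall x, app f x = app g x) -> f = g.

Definition models (M : structure) (T : theory) : Prop :=
  forall V A, T V A -> forall e : env M V, sat e A.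

(** * The Henkin construction: a complete theory with witnesses *)

Section Henkin.
Variable T : theory.
Hypothesis cT : subst_closed T.
Hypothesis extT : forall V s t (f : tm V (s ⟶ t)) x y, T (eqT x y ⇒ eqT (f @ x) (f @ y)).

(** The Henkin constants are free variables, countably many of each type. *)
Definition consts : ctx := fun _ => nat.
Notation W := consts.

Lemma prv_hd V (G : list (fm V)) A : prv T (A :: G) A.
Proof. by apply: prHyp; left. Qed.

Lemma prv_cut V (G : list (fm V)) A B : prv T G A -> prv T (A :: G) B -> prv T G B.
Proof. by move=> HA HB; apply: prImpE HA; apply: prImpI. Qed.

Lemma prv_wk1 V (G : list (fm V)) A B : prv T G A -> prv T (B :: G) A.
Proof. by move=> H; apply: prv_weak H _ _ => ? ?; right. Qed.

Lemma prv_bot V (G : list (fm V)) A : prv T G Bot -> prv T G A.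
Proof. by move=> H; apply/prRAA/prv_wk1. Qed.

(** Renames the constant [c] of type [s] to the newest variable. *)
Definition abstract_const s (c : nat) : sub W (ext W s) :=
  fun t x => match ty_eq_dec s t with
    | left e => if Nat.eqb x c then
        match e in _ = t return tm (ext W s) t with eq_refl => Var vz end
        else Var (vs x)
    | right _ => Var (vs x)
    end.

Lemma abstract_const_same s c : @abstract_const s c s c = Var vz.
Proof.
rewrite /abstract_const; case: ty_eq_dec => // e; rewrite Nat.eqb_refl.
by rewrite (UIP_dec ty_eq_dec e eq_refl).
Qed.

Lemma abstract_const_fresh s c t (x : W t) : x < c -> @abstract_const s c t x = Var (vs x).
Proof.
move=> lt_xc; rewrite /abstract_const; case: ty_eq_dec => // e.
by rewrite (proj2 (Nat.eqb_neq x c)) //; lia.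
Qed.

(** Take [c] above all constants in [G] and [B]. A refutation of the instance at [c] becomes, once
    [c] is abstracted to a new variable, a refutation of [B], and existential elimination then
    refutes [G]. *)
Lemma henkin_witness (G : list (fm W)) s (B : fm (ext W s)) :
  prv T G (Ex s B) -> ~ prv T G Bot ->
  exists c : W s, ~ prv T (inst B (Var c) :: G) Bot.
Proof.
move=> GE cG; have [c [fB fG]] : exists c,
    free_in (lift_pred (fun t (x : W t) => x < c) (s := s)) B /\
    forall A, In A G -> free_in (fun t (x : W t) => x < c) A.
  have [n Hn] := free_in_bound B (ext_code (fun t (x : W t) => x) (s := s)).
  have [m Hm] : exists m, forall A, In A G -> free_in (fun t (x : W t) => x < m) A.
    elim: G {GE cG} => [|A G [m Hm]]; first by exists 0.
    have [k Hk] := free_in_bound A (fun t (x : W t) => x).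
    exists (k + m) => C [<-|/Hm]; last by apply: free_in_mono => t x; lia.
    by move: Hk; apply: free_in_mono => t x; lia.
  exists (n + m); split; first by move: Hn; apply: free_in_mono => t [] //= u x; lia.
  by move=> A /Hm; apply: free_in_mono => t x; lia.
exists c => /(prv_subst cT) /(_ _ (abstract_const s c)) /=.
have -> : subf (abstract_const s c) (inst B (Var c)) = B.
  rewrite /inst subf_subf -[RHS]subf_ids; apply: subf_free fB => t [|u x] /=.
    by move=> _; rewrite /comps /= abstract_const_same.
  by move=> H; rewrite /comps /= abstract_const_fresh.
have -> : map (subf (abstract_const s c)) G = map (shift s) G.
  apply: map_ext_in => A /fG fA; rewrite shift_subf; apply: subf_free fA => t x.
  exact: abstract_const_fresh.
by move=> H; apply: cG; exact: (prExE (B := Bot) GE H).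
Qed.

(** A formula consistent with [G] is added, with a witness if it is existential. A formula refuted
    by [G] cannot be a member of the consistent [G], so for it the witness clause is vacuous. *)
Lemma henkin_step (G : list (fm W)) A : ~ prv T G Bot ->
  exists G', incl G G' /\ ~ prv T G' Bot /\ (In A G' \/ prv T (A :: G) Bot) /\
    forall s B, A = Ex s B -> In A G' -> exists c, In (inst B (Var c)) G'.
Proof.
move=> cG; case: (classic (prv T (A :: G) Bot)) => cA.
  exists G; split; first by move=> ?.
  split=> //; split; first by right.
  by move=> s B _ /prHyp iA; case: cG; apply: prv_cut (iA _) cA.
case: (classic (exists s B, A = Ex s B)) => [[s [B E]]|nE]; last first.
  exists (A :: G); split; first by move=> ? ?; right.
  split=> //; split; first by left; left.
  by move=> s B E; case: nE; exists s, B.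
subst A; have [c Hc] := henkin_witness (prv_hd _ _) cA.
exists (inst B (Var c) :: Ex s B :: G); split; first by move=> ? ?; right; right.
split=> //; split; first by left; right; left.
move=> u C E _; exists c.
have Es : s = u by case: E.
by subst u; injection E => E'; rewrite (existT_ty_inj E'); left.
Qed.

Variable phi : fm noVar.
Hypothesis nphi : ~ prv T nil phi.

Definition closed_sub (V : ctx) : sub noVar V := fun s (x : noVar s) => match x with end.

Definition start : list (fm W) := [∼ (subf (@closed_sub W) phi)].

Lemma start_consistent : ~ prv T start Bot.
Proof.
(* Replacing every constant by the closed term [one s] of its type returns the refutation to the
   empty context, where it proves [phi]. *)
move=> /(prv_subst cT) /(_ noVar (fun s _ => one s)); rewrite /start /= subf_subf.
rewrite (subf_ext _ (g := @ids noVar)); last by move=> s [].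
by rewrite subf_ids => H; apply/nphi/prRAA.
Qed.

Definition consistent_list := {G : list (fm W) | ~ prv T G Bot}.

Definition fm_code (A : fm W) : nat := code_fm (fun t (x : W t) => x) A.

Lemma fm_code_inj A B : fm_code A = fm_code B -> A = B.
Proof. by apply: code_fm_inj => s x y. Qed.

Definition step_spec n (G G' : consistent_list) : Prop :=
  incl (proj1_sig G) (proj1_sig G') /\
  forall A, fm_code A = n ->
    (In A (proj1_sig G') \/ prv T (A :: proj1_sig G) Bot) /\
    forall s B, A = Ex s B -> In A (proj1_sig G') ->
      exists c, In (inst B (Var c)) (proj1_sig G').

Lemma step_exists n G : exists G', step_spec n G G'.
Proof.
case: (classic (exists A, fm_code A = n)) => [[A <-]|nA]; last first.
  by exists G; split=> [?|A EA] //; case: nA; exists A.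
have [G' [i [c H]]] := henkin_step A (proj2_sig G).
by exists (exist _ G' c); split=> // B /fm_code_inj ->.
Qed.

Fixpoint stage n : consistent_list :=
  match n with
  | 0 => exist _ start start_consistent
  | S n => proj1_sig (constructive_indefinite_description _ (step_exists n (stage n)))
  end.

Lemma stage_spec n : step_spec n (stage n) (stage (S n)).
Proof. by rewrite /=; case: constructive_indefinite_description. Qed.

Lemma stage_mono n m : n <= m -> incl (proj1_sig (stage n)) (proj1_sig (stage m)).
Proof.
elim=> [|{}m _ IH] A iA //.
by apply: (proj1 (stage_spec m)); apply: IH.
Qed.

(** The deductive closure of the union of the stages. The lemmas that follow show that it commutes
    with the connectives and quantifiers, as truth in a model does. *)
Definition holds (A : fm W) : Prop := exists n, prv T (proj1_sig (stage n)) A.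

(** The stages increase, so finitely many premises are available at a common stage. *)
Lemma holds_list (G : list (fm W)) A :
  (forall B, In B G -> holds B) -> prv T G A -> holds A.
Proof.
elim: G A => [|B G IH] A HG HA; first by exists 0; apply: prv_weak HA _ _.
have [n Hn] : holds (B ⇒ A).
  by apply: IH; [move=> C iC; apply: HG; right|apply: prImpI].
have [m Hm] : holds B by apply: HG; left.
exists (n + m); apply: prImpE.
  by apply: (prv_weak Hn); apply: stage_mono; lia.
by apply: (prv_weak Hm); apply: stage_mono; lia.
Qed.

Lemma holds_prv A : prv T nil A -> holds A.
Proof. exact: holds_list. Qed.

Lemma holds_1 A B : prv T [A] B -> holds A -> holds B.
Proof. by move=> H HA; apply: holds_list H => C [<-|[]]. Qed.

Lemma holds_2 A B C : prv T [A; B] C -> holds A -> holds B -> holds C.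
Proof. by move=> H HA HB; apply: holds_list H => D [<-|[<-|[]]]. Qed.

Lemma holds_bot : ~ holds Bot.
Proof. by case=> n; apply: (proj2_sig (stage n)). Qed.

Lemma holds_phi : ~ holds (subf (@closed_sub W) phi).
Proof.
move=> H; apply: holds_bot; apply: holds_2 H _; last by exists 0; apply: prv_hd.
by apply: (prImpE (A := subf (@closed_sub W) phi)); apply: prHyp; [right; left|left].
Qed.

Lemma holds_em A : holds A \/ holds (∼ A).
Proof.
have [_ /(_ A eq_refl) [[iA|iA] _]] := stage_spec (fm_code A).
  by left; exists (S (fm_code A)); apply: prHyp.
by right; exists (fm_code A); apply: prImpI.
Qed.

Lemma holds_not A : holds (∼ A) <-> ~ holds A.
Proof.
split=> [HN HA|].
  apply: holds_bot; apply: holds_2 HN HA.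
  by apply: (prImpE (A := A)); apply: prHyp; [left|right; left].
by case: (holds_em A).
Qed.

Lemma holds_ex s (B : fm (ext W s)) : holds (Ex s B) <-> exists a, holds (inst B a).
Proof.
split=> [H|[a H]]; last by apply: holds_1 H; apply: (prExI (a := a)); apply: prv_hd.
(* The step that treats the code of [Ex s B] adds the formula, since a refutation would contradict
   [H], and with it a witness. *)
have [i /(_ _ eq_refl) [iA /(_ _ _ eq_refl) w]] := stage_spec (fm_code (Ex s B)).
have E : In (Ex s B) (proj1_sig (stage (S (fm_code (Ex s B))))).
  case: iA => // HN; have : holds (∼ (Ex s B)) by exists (fm_code (Ex s B)); apply: prImpI.
  by move=> /holds_not.
by have [c ic] := w E; exists (Var c); exists (S (fm_code (Ex s B))); apply: prHyp.
Qed.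

(** A witness of [Ex s (∼ B)] would be a counterexample to the instances; so [∼ Ex s (∼ B)] holds,
    and [All s B] follows from it classically. *)
Lemma holds_all s (B : fm (ext W s)) : holds (All s B) <-> forall a, holds (inst B a).
Proof.
split=> [H a|H]; first by apply: holds_1 H; apply: prAllE; apply: prv_hd.
case: (holds_em (Ex s (∼ B))) => [/holds_ex [a Ha]|HN].
  have /holds_not : holds (∼ (inst B a)) by exact: Ha.
  by case.
apply: holds_1 HN; apply: prAllI; apply: prRAA => /=.
apply: (prImpE (A := Ex s (subf (lifts (fun u x => Var (vs x))) (∼ B)))).
  by apply: prHyp; right; left; rewrite shift_subf.
apply: (prExI (a := Var vz)); rewrite inst_lifts.
rewrite (subf_ext _ (g := @ids _)); last by move=> t [].
by rewrite subf_ids; apply: prv_hd.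
Qed.

Lemma holds_and A B : holds (A ⋏ B) <-> holds A /\ holds B.
Proof.
split=> [H|[HA HB]].
  by split; apply: holds_1 H; [apply: prAndE1 (prv_hd _ _)|apply: prAndE2 (prv_hd _ _)].
by apply: holds_2 HA HB; apply: prAndI; apply: prHyp; [left|right; left].
Qed.

Lemma holds_imp A B : holds (A ⇒ B) <-> (holds A -> holds B).
Proof.
split=> [H HA|H].
  by apply: holds_2 H HA; apply: (prImpE (A := A)); apply: prHyp; [left|right; left].
case: (holds_em A) => [/H|] H1; apply: holds_1 H1.
  by apply: prImpI; apply: prHyp; right; left.
apply: prImpI; apply: prv_bot.
by apply: (prImpE (A := A)); apply: prHyp; [right; left|left].
Qed.

Lemma holds_or A B : holds (A ⋎ B) <-> holds A \/ holds B.
Proof.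
split=> [H|[H|H]]; last 2 first.
- by apply: holds_1 H; apply/prOrI1/prv_hd.
- by apply: holds_1 H; apply/prOrI2/prv_hd.
- case: (holds_em A) => HA; first by left.
right; apply: holds_2 H HA; apply: prOrE; first exact: prv_hd.
  apply: prv_bot; apply: (prImpE (A := A)); last exact: prv_hd.
  by apply: prHyp; right; right; left.
exact: prv_hd.
Qed.

(** * The extensional collapse of the term model *)

Fixpoint teq s : tm W s -> tm W s -> Prop :=
  match s with
  | tyN => fun a b => holds (a ≐ b)
  | Arr s t => fun f g => forall x, teq (f @ x) (g @ x)
  end.

Lemma holds_eqT s (a b : tm W s) : holds (eqT a b) <-> teq a b.
Proof.
elim: s a b => //= s _ t IH a b; rewrite holds_all.
by split=> H x; move: (H x); rewrite /inst subf_eqT /= !subt_scons_wk !subt_ids IH.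
Qed.

Lemma holds_subst (A : fm (ext W tyN)) a b :
  holds (a ≐ b) -> holds (inst A a) -> holds (inst A b).
Proof. by apply: holds_2; apply: prEqSubst; apply: prHyp; [left|right; left]. Qed.

Lemma teq_refl s (a : tm W s) : teq a a.
Proof. by elim: s a => //= a; apply/holds_prv/prEqRefl. Qed.

Lemma teq_sym s (a b : tm W s) : teq a b -> teq b a.
Proof.
elim: s a b => [|s _ t IH] a b /= H; last by move=> x; apply/IH/H.
have := @holds_subst (v0 ≐ wk a) a b H; rewrite /inst /= !subt_scons_wk !subt_ids.
by apply; apply: (@teq_refl tyN).
Qed.

Lemma teq_trans s (a b c : tm W s) : teq a b -> teq b c -> teq a c.
Proof.
elim: s a b c => [|s _ t IH] a b c /= H1 H2; last by move=> x; apply: IH (H1 x) (H2 x).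
have := @holds_subst (wk a ≐ v0) b c H2; rewrite /inst /= !subt_scons_wk !subt_ids.
by apply.
Qed.

(** Congruence in the function is part of the definition of [teq]; congruence in the argument is the
    extensionality axiom. *)
Lemma teq_app s t (f g : tm W (s ⟶ t)) a b : teq f g -> teq a b -> teq (f @ a) (g @ b).
Proof.
move=> fg ab; apply: teq_trans (fg b).
apply/holds_eqT; move: ab => /holds_eqT; apply/holds_imp.
by apply/holds_prv/prAx/extT.
Qed.

Lemma holds_lt a b c d : teq a c -> teq b d -> holds (a ≺ b) -> holds (c ≺ d).
Proof.
move=> ac bd H.
have := @holds_subst (v0 ≺ wk d) a c ac; rewrite /inst /= !subt_scons_wk !subt_ids; apply.
have := @holds_subst (wk a ≺ v0) b d bd; rewrite /inst /= !subt_scons_wk !subt_ids; apply.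
exact: H.
Qed.

(** Equivalent terms have equal predicates [teq a], so [epsilon] chooses the same representative for
    both. The quotient is thereby realised by the fixed points of [canon], and equality in it is
    identity. *)
Definition canon s (a : tm W s) : tm W s := epsilon (inhabits a) (teq a).

Lemma canon_teq s (a : tm W s) : teq a (canon a).
Proof. by apply: epsilon_spec; exists a; apply: teq_refl. Qed.

Lemma canon_eq s (a b : tm W s) : teq a b -> canon a = canon b.
Proof.
move=> ab; rewrite /canon (_ : teq a = teq b); last first.
  apply: functional_extensionality => c; apply: propositional_extensionality.
  by split; apply: teq_trans => //; apply: teq_sym.
by rewrite (proof_irrelevance _ (inhabits a) (inhabits b)).
Qed.

Definition class s : Set := {a : tm W s | canon a = a}.

Definition cls s (a : tm W s) : class s :=
  exist _ (canon a) (eq_sym (canon_eq (canon_teq a))).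

Definition rep s (d : class s) : tm W s := proj1_sig d.

Lemma rep_inj s (c d : class s) : rep c = rep d -> c = d.
Proof.
case: c d => [a p] [b q] /= E; subst b.
by rewrite (proof_irrelevance _ p q).
Qed.

Lemma cls_eq s (a b : tm W s) : cls a = cls b <-> teq a b.
Proof.
split=> [E|/canon_eq E]; last exact: rep_inj.
have E' : canon a = canon b by exact: (f_equal (@rep s) E).
apply: teq_trans (canon_teq a) _; rewrite E'; apply: teq_sym; exact: canon_teq.
Qed.

Lemma cls_rep s (d : class s) : cls (rep d) = d.
Proof. by apply: rep_inj; case: d. Qed.

Definition term_model : structure := {|
  dom := class;
  app s t f x := cls (rep f @ rep x);
  int_cst s c := cls (Cst c);
  lt x y := holds (rep x ≺ rep y) |}.

Lemma rep_cls s (a : tm W s) : teq a (rep (cls a)).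
Proof. exact: canon_teq. Qed.

Lemma ev_term_model V (f : sub V W) s (a : tm V s) :
  ev (M := term_model) (fun t x => cls (f t x)) a = cls (subt f a).
Proof.
elim: a => //= u v g -> b ->; apply/cls_eq.
by apply: teq_app; apply: teq_sym; apply: rep_cls.
Qed.

(** Every element of the model is the class of a term, so environments of the form [cls (f t x)]
    cover all of them, and a quantifier extends [f] by one representative. *)
Lemma truth V (A : fm V) : forall f : sub V W,
  sat (M := term_model) (fun t x => cls (f t x)) A <-> holds (subf f A).
Proof.
have E : forall V (f : sub V W) s (B : fm (ext V s)) (a : tm W s),
    sat (M := term_model) (econs (M := term_model) (cls a) (fun t x => cls (f t x))) B <->
    sat (M := term_model) (fun t x => cls (scons a f x)) B.
  by move=> ? f s B a; apply: sat_ext => t [].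
elim: A => {V} /=.
- by move=> V a b f; rewrite !ev_term_model cls_eq.
- move=> V a b f; rewrite !ev_term_model; split; apply: holds_lt; try exact: rep_cls;
  apply: teq_sym; exact: rep_cls.
- by move=> V f; split=> // /holds_bot.
- by move=> V A HA B HB f; rewrite HA HB holds_and.
- by move=> V A HA B HB f; rewrite HA HB holds_or.
- by move=> V A HA B HB f; rewrite HA HB holds_imp.
- move=> V s A HA f; rewrite holds_all; split=> H a.
    by rewrite inst_lifts -HA -E.
  by rewrite -(cls_rep a) E HA -inst_lifts.
- move=> V s A HA f; rewrite holds_ex; split=> - [a H].
    by exists (rep a); rewrite inst_lifts -HA -E cls_rep.
  by exists (cls a); rewrite E HA -inst_lifts.
Qed.

Lemma term_model_ext : extensional term_model.
Proof.
move=> s t f g H; rewrite -(cls_rep f) -(cls_rep g); apply/cls_eq => x.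
have /cls_eq H1 := H (cls x).
apply: teq_trans (teq_trans H1 _); last by apply: teq_app (teq_refl _) (teq_sym (rep_cls _)).
exact: teq_app (teq_refl _) (rep_cls _).
Qed.

Lemma term_model_models : models term_model T.
Proof.
move=> V A TA e; have -> : e = fun t x => cls (rep (e t x)).
  by do 2 apply: functional_extensionality_dep => ?; rewrite cls_rep.
apply/(truth A (fun t x => rep (e t x))).
by apply/holds_prv/prAx/cT.
Qed.

Lemma term_model_phi (e : env term_model noVar) : ~ sat e phi.
Proof.
rewrite (sat_ext _ (M := term_model) (e' := fun t x => cls (@closed_sub W t x))); last by move=> t [].
by rewrite (truth phi (@closed_sub W)); apply: holds_phi.
Qed.

End Henkin.

Definition no_env M : env M noVar := fun s (x : noVar s) => match x with end.

(** If [phi] is unprovable, the collapsed term model of the complete theory grown from its negation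
    satisfies [T] but not [phi]. *)
Theorem completeness (T : theory) (phi : fm noVar) :
  subst_closed T ->
  (forall V s t (f : tm V (s ⟶ t)) x y, T V (eqT x y ⇒ eqT (f @ x) (f @ y))) ->
  (forall M, extensional M -> models M T -> sat (no_env M) phi) ->
  proves T phi.
Proof.
move=> cT extT H; apply: NNPP => nphi.
apply: (@term_model_phi T cT extT phi nphi); apply: H.
  exact: term_model_ext.
exact: term_model_models.
Qed.

(** * Arithmetic in an extensional model *)

Lemma ev_wk M V (e : env M V) s (d : dom M s) t (a : tm V t) : ev (econs d e) (wk a) = ev e a.
Proof. by elim: a => //= u v f -> b ->. Qed.

Lemma sat_eqT M V (e : env M V) s (a b : tm V s) :
  extensional M -> sat e (eqT a b) <-> ev e a = ev e b.
Proof.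
move=> extM; elim: s V e a b => //= s _ t IH V e a b; split=> [H|E d].
  by apply: extM => d; move: (H d); rewrite IH /= !ev_wk.
by rewrite IH /= !ev_wk E.
Qed.

Section Model.
Variable M : structure.
Hypothesis extM : extensional M.
Hypothesis MT : models M (extend RCA0w (QFAC ty2 tyN)).

Notation D := (dom M).
Notation N := (dom M tyN).
Notation "f · x" := (app f x) (at level 20, left associativity).

(** The domains of the model serve as the context: its elements are the variables, so axioms can be
    instantiated directly with elements as parameters. *)
Definition env_id : env M D := fun s d => d.

Lemma rca (A : fm D) : RCA0w A -> sat env_id A.
Proof. by move=> H; apply: MT; left. Qed.

Definition zero : N := int_cst c0.
Definition one' : N := int_cst c1.
Definition add (x y : N) : N := int_cst cadd · x · y.
Definition mul (x y : N) : N := int_cst cmul · x · y.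

Declare Scope model_scope.
Local Open Scope model_scope.
Local Notation "0" := zero : model_scope.
Local Notation "1" := one' : model_scope.
Local Notation "x + y" := (add x y) : model_scope.
Local Notation "x * y" := (mul x y) : model_scope.
Local Notation "x < y" := (lt x y) : model_scope.

Definition le (x y : N) : Prop := x < y \/ x = y.
Local Notation "x <= y" := (le x y) : model_scope.

Lemma addA (x y z : N) : x + y + z = x + (y + z).
Proof. exact: rca (ax_addA (V := D) (Var x) (Var y) (Var z)). Qed.
Lemma addC (x y : N) : x + y = y + x.
Proof. exact: rca (ax_addC (V := D) (Var x) (Var y)). Qed.
Lemma mulA (x y z : N) : x * y * z = x * (y * z).
Proof. exact: rca (ax_mulA (V := D) (Var x) (Var y) (Var z)). Qed.
Lemma mulC (x y : N) : x * y = y * x.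
Proof. exact: rca (ax_mulC (V := D) (Var x) (Var y)). Qed.
Lemma mulDr (x y z : N) : x * (y + z) = x * y + x * z.
Proof. exact: rca (ax_mulDr (V := D) (Var x) (Var y) (Var z)). Qed.
Lemma addx0 (x : N) : x + 0 = x.
Proof. exact: rca (ax_add0 (V := D) (Var x)). Qed.
Lemma mulx0 (x : N) : x * 0 = 0.
Proof. exact: rca (ax_mul0 (V := D) (Var x)). Qed.
Lemma mulx1 (x : N) : x * 1 = x.
Proof. exact: rca (ax_mul1 (V := D) (Var x)). Qed.

Lemma N_srt : semi_ring_theory 0 1 add mul (@eq N).
Proof.
split=> *.
- by rewrite addC addx0.
- exact: addC.
- by rewrite addA.
- by rewrite mulC mulx1.
- by rewrite mulC mulx0.
- exact: mulC.
- by rewrite mulA.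
- by rewrite mulC mulDr; congr add; exact: mulC.
Qed.

Add Ring N_ring : N_srt.

Lemma lt_irr (x : N) : ~ x < x.
Proof. exact: rca (ax_lt_irr (V := D) (Var x)). Qed.
Lemma lt_trans (x y z : N) : x < y -> y < z -> x < z.
Proof. by move=> xy yz; apply: (rca (ax_lt_trans (V := D) (Var x) (Var y) (Var z))). Qed.
Lemma lt_total (x y : N) : x < y \/ x = y \/ y < x.
Proof. exact: rca (ax_lt_total (V := D) (Var x) (Var y)). Qed.
Lemma lt_add (x y z : N) : x < y -> x + z < y + z.
Proof. exact: rca (ax_lt_add (V := D) (Var x) (Var y) (Var z)). Qed.
Lemma lt_sub (x y : N) : x < y -> exists z, x + z = y.
Proof. exact: rca (ax_lt_sub (V := D) (Var x) (Var y)). Qed.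
Lemma lt01 : 0 < 1.
Proof. exact: rca (ax_lt01 D). Qed.
Lemma discrete (x : N) : 0 < x -> 1 <= x.
Proof. exact: rca (ax_discrete (V := D) (Var x)). Qed.
Lemma le0x (x : N) : 0 <= x.
Proof. exact: rca (ax_le0 (V := D) (Var x)). Qed.

Lemma le_refl (x : N) : x <= x.
Proof. by right. Qed.
Lemma ltW (x y : N) : x < y -> x <= y.
Proof. by left. Qed.
Lemma le_lt_trans (x y z : N) : x <= y -> y < z -> x < z.
Proof. by case=> [|->] //; apply: lt_trans. Qed.
Lemma lt_le_trans (x y z : N) : x < y -> y <= z -> x < z.
Proof. by move=> xy [|<-] //; apply: lt_trans. Qed.
Lemma le_trans (x y z : N) : x <= y -> y <= z -> x <= z.
Proof. by case=> [xy|->] // yz; left; apply: lt_le_trans yz. Qed.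
Lemma le_add (x y z : N) : x <= y -> x + z <= y + z.
Proof. by case=> [/lt_add|->]; [left|right]. Qed.
Lemma le_addr (x y : N) : x <= x + y.
Proof. by have := le_add x (le0x y); rewrite (_ : 0 + x = x) 1?(addC y); [|ring]. Qed.
Lemma le_ex (x y : N) : x <= y -> exists z, x + z = y.
Proof. by case=> [/lt_sub|->] //; exists 0; ring. Qed.
Lemma le_or_lt (x y : N) : x <= y \/ y < x.
Proof. by case: (lt_total x y) => [|[]]; [left; left|left; right|right]. Qed.
Lemma not_lt (x y : N) : ~ x < y <-> y <= x.
Proof.
split=> [|yx xy]; first by case: (le_or_lt y x).
exact: lt_irr (lt_le_trans xy yx).
Qed.
Lemma add_inj (x y z : N) : x + z = y + z -> x = y.
Proof.
by case: (lt_total x y) => [|[//|]] /(lt_add z) H E; move: H; rewrite E => /lt_irr.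
Qed.
Lemma ltS (x : N) : x < x + 1.
Proof. by have := lt_add x lt01; rewrite addC addx0 addC. Qed.
Lemma lt_le_S (x y : N) : x < y -> x + 1 <= y.
Proof.
move=> xy; have [z Ez] := lt_sub xy.
have z0 : 0 < z.
  by case: (le0x z) => // E; move: xy; rewrite -Ez -E addx0 => /lt_irr.
by rewrite -Ez !(addC x); apply/le_add/discrete.
Qed.
Lemma ltS_le (x y : N) : x < y + 1 <-> x <= y.
Proof.
split=> [H|H]; last exact: le_lt_trans H (ltS _).
by apply/not_lt => /lt_le_S /not_lt.
Qed.
Lemma lt0 (x : N) : ~ x < 0.
Proof. by apply/not_lt/le0x. Qed.
Lemma zero_or_S (x : N) : x = 0 \/ exists y, x = y + 1.
Proof.
case: (le0x x) => [/discrete /le_ex [y <-]|->]; last by left.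
by right; exists y; ring.
Qed.
Lemma S_neq0 (x : N) : x + 1 <> 0.
Proof. by move=> E; apply: (@lt0 x); rewrite -E; apply: ltS. Qed.
Lemma one_neq0 : 1 <> 0.
Proof. by move=> E; apply: (@lt0 0); rewrite -{2}E; apply: lt01. Qed.
Lemma pos_neq0 (x : N) : 0 < x <-> x <> 0.
Proof. by split=> [H E|H]; [move: H; rewrite E => /lt_irr|case: (le0x x) => // E; case: H]. Qed.
Lemma le_mul (x y z : N) : x <= y -> x * z <= y * z.
Proof. by move=> /le_ex [w <-]; rewrite (_ : (x + w) * z = x * z + w * z); [apply: le_addr|ring]. Qed.
Lemma le1 (x : N) : x <= 1 <-> x = 0 \/ x = 1.
Proof.
split=> [[H|]|[->|->]]; [|by right|exact: le0x|exact: le_refl].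
left; case: (zero_or_S x) => // - [y E]; case: (lt_irr (x := 1)).
by apply: le_lt_trans H; rewrite E addC; apply: le_addr.
Qed.

(** The pairing behind [snoc]: the value of [snoc s a] is [pair s a + 1]. *)
Definition pair (x y : N) : N := (x + y) * (x + y) + x.

(** [pair x y] is at least the square of [x + y] and below the square of [x + y + 1], so the order
    of codes respects the order of the sums. *)
Lemma pair_lt (x y a b : N) : x + y < a + b -> pair x y < pair a b.
Proof.
move=> /lt_le_S H; rewrite /pair.
have H1 : (x + y + 1) * (x + y + 1) <= (a + b) * (a + b).
  apply: le_trans (le_mul _ H) _.
  by rewrite mulC; apply: le_mul.
apply: lt_le_trans (le_trans H1 (le_addr _ _)).
rewrite (_ : (x + y + 1) * (x + y + 1) = (x + y) * (x + y) + x + (x + y + y) + 1); [|ring].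
by apply/ltS_le/le_addr.
Qed.

Lemma pair_inj (x y a b : N) : pair x y = pair a b -> x = a /\ y = b.
Proof.
move=> E; case: (lt_total (x + y) (a + b)) => [/pair_lt|[Es|/pair_lt]]; rewrite ?E; try by move=> /lt_irr.
have Ex : x = a.
  by move: E; rewrite /pair Es => E; apply: (@add_inj _ _ ((a + b) * (a + b))); rewrite addC E addC.
by split=> //; move: Es; rewrite Ex ![a + _]addC => /add_inj.
Qed.

Lemma le_sq (x : N) : x <= x * x.
Proof.
case: (zero_or_S x) => [->|[y ->]]; first by right; ring.
by rewrite (_ : (y + 1) * (y + 1) = y + 1 + (y * y + y)); [apply: le_addr|ring].
Qed.

Lemma pair_ge1 (x y : N) : x < pair x y + 1.
Proof. by apply/ltS_le; rewrite /pair addC; apply: le_addr. Qed.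

Lemma pair_ge2 (x y : N) : y < pair x y + 1.
Proof.
apply/ltS_le; apply: (le_trans (y := x + y)); first by rewrite addC; apply: le_addr.
exact: le_trans (le_sq _) (le_addr _ _).
Qed.

(** * Definable functions *)

Lemma appK s t (x : D s) (y : D t) : int_cst (cK s t) · x · y = x.
Proof. exact: (proj1 (sat_eqT _ _ _ extM) (rca (ax_K (V := D) (Var x) (Var y)))). Qed.

Lemma appS r s t (x : D (r ⟶ s ⟶ t)) (y : D (r ⟶ s)) (z : D r) :
  int_cst (cS r s t) · x · y · z = x · z · (y · z).
Proof. exact: (proj1 (sat_eqT _ _ _ extM) (rca (ax_S (V := D) (Var x) (Var y) (Var z)))). Qed.

Fixpoint dflt s : D s :=
  match s with tyN => 0 | Arr s t => int_cst (cK t s) · dflt t end.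

(** Choosing the element by [epsilon] avoids explicit combinator terms; the value is meaningful once
    some element represents [B], which [Lam_spec] obtains from definability. *)
Definition Lam s t (B : D s -> D t) : D (s ⟶ t) :=
  epsilon (inhabits (dflt (s ⟶ t))) (fun f => forall x, f · x = B x).

(** [tele l] lists the values of parameters of the types [l], the newest one
    being the second component of the outermost pair. *)
Fixpoint tele (l : list ty) : Type :=
  match l with nil => unit | s :: l => (tele l * D s)%type end.

Fixpoint arrs (l : list ty) (t : ty) : ty :=
  match l with nil => t | s :: l => arrs l (s ⟶ t) end.

Fixpoint apps l t : D (arrs l t) -> tele l -> D t :=
  match l with
  | nil => fun f _ => f
  | s :: l => fun f e => apps (l := l) (t := s ⟶ t) f (fst e) · snd e
  end.

(** Combinatory completeness takes the form of closure properties of this notion: [K] yields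
    constants and weakening, [S] yields application. *)
Definition definable l t (F : tele l -> D t) : Prop :=
  exists f, forall e, apps f e = F e.

Lemma def_const l t (c : D t) : definable (l := l) (fun _ => c).
Proof.
elim: l t c => [|s l IH] t c; first by exists c.
by have [f Hf] := IH _ (int_cst (cK t s) · c); exists f => e /=; rewrite Hf appK.
Qed.

Lemma def_app l s t (F : tele l -> D (s ⟶ t)) (G : tele l -> D s) :
  definable F -> definable G -> definable (fun e => F e · G e).
Proof.
elim: l s t F G => [|r l IH] s t F G [f Hf] [g Hg].
  by exists (f · g) => e /=; rewrite -Hf -Hg.
(* [S] passes the newest parameter to both sides; the induction hypothesis treats the older ones. *)
have D1 : definable (fun e => int_cst (cS r s t) · apps (l := l) (t := r ⟶ s ⟶ t) f e · apps (l := l) (t := r ⟶ s) g e).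
  by apply: (IH); [apply: (IH); [apply: def_const|exists f]|exists g].
case: D1 => h Hh; exists h => e /=.
by rewrite Hh appS -Hf -Hg.
Qed.

Lemma def_v0 s l : definable (fun e : tele (s :: l) => snd e).
Proof.
(* This is [S K K], the identity. *)
have [h Hh] := def_const l (int_cst (cS s (tyN ⟶ s) s) · int_cst (cK s (tyN ⟶ s)) · int_cst (cK s tyN)).
by exists h => e /=; rewrite Hh appS appK.
Qed.

Lemma def_weak s l t (F : tele l -> D t) :
  definable F -> definable (fun e : tele (s :: l) => F (fst e)).
Proof.
move=> [f Hf].
have [h Hh] : definable (fun e => int_cst (cK t s) · F e).
  by apply: def_app; [apply: def_const|exists f].
by exists h => e /=; rewrite Hh appK.
Qed.

Lemma def_v1 r s l : definable (fun e : tele (r :: s :: l) => snd (fst e)).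
Proof. exact: def_weak (def_v0 _ _). Qed.
Lemma def_v2 q r s l : definable (fun e : tele (q :: r :: s :: l) => snd (fst (fst e))).
Proof. exact: def_weak (def_v1 _ _ _). Qed.
Lemma def_v3 p q r s l :
  definable (fun e : tele (p :: q :: r :: s :: l) => snd (fst (fst (fst e)))).
Proof. exact: def_weak (def_v2 _ _ _ _). Qed.
Lemma def_v4 o p q r s l :
  definable (fun e : tele (o :: p :: q :: r :: s :: l) => snd (fst (fst (fst (fst e))))).
Proof. exact: def_weak (def_v3 _ _ _ _ _). Qed.

Lemma def_ext l t (F G : tele l -> D t) : (forall e, F e = G e) -> definable F -> definable G.
Proof. by move=> E [f Hf]; exists f => e; rewrite Hf. Qed.

Lemma Lam_spec s t (B : D s -> D t) :
  definable (l := [s]) (fun e => B (snd e)) -> forall x, Lam B · x = B x.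
Proof.
move=> [f Hf]; apply: (epsilon_spec (inhabits (dflt (s ⟶ t))) (fun g => forall x, g · x = B x)).
by exists f => x; apply: (Hf (tt, x)).
Qed.

(** By extensionality the chosen [Lam (B e)] equals the partial application to [e] of the element
    representing [B], hence depends definably on [e]. *)
Lemma def_lam l s t (B : tele l -> D s -> D t) :
  definable (l := s :: l) (fun e => B (fst e) (snd e)) ->
  definable (fun e => Lam (B e)).
Proof.
move=> [f Hf]; exists f => e; apply: extM => x.
rewrite /Lam; apply: (eq_trans (Hf (e, x))) => /=; apply: eq_sym.
move: x; apply: (epsilon_spec (inhabits (dflt (s ⟶ t))) (fun g => forall x, g · x = B e x)).
by exists (apps (l := l) (t := s ⟶ t) f e) => x; apply: (Hf (e, x)).
Qed.

Lemma def_add l (F G : tele l -> N) :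
  definable F -> definable G -> definable (fun e => F e + G e).
Proof.
by move=> HF HG; apply: (def_app (F := fun e => int_cst cadd · F e)) => //; apply: def_app => //; apply: def_const.
Qed.

Lemma def_mul l (F G : tele l -> N) :
  definable F -> definable G -> definable (fun e => F e * G e).
Proof.
by move=> HF HG; apply: (def_app (F := fun e => int_cst cmul · F e)) => //; apply: def_app => //; apply: def_const.
Qed.

Lemma def_pair l (F G : tele l -> N) :
  definable F -> definable G -> definable (fun e => pair (F e) (G e)).
Proof. by move=> HF HG; apply: def_add => //; apply: def_mul; apply: def_add. Qed.

(** * Recursion, decidable predicates and bounded search *)

Lemma R0 (f : D ty1) (m : N) : int_cst cR · f · m · 0 = m.
Proof. exact: rca (ax_R0 (V := D) (Var f) (Var m)). Qed.
Lemma RS (f : D ty1) (m n : N) : int_cst cR · f · m · (n + 1) = f · (int_cst cR · f · m · n).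
Proof. exact: rca (ax_RS (V := D) (Var f) (Var m) (Var n)). Qed.

Lemma ind0 (d : D ty1) : d · 0 = 0 -> (forall n, d · n = 0 -> d · (n + 1) = 0) ->
  forall n, d · n = 0.
Proof.
move=> H0 HS; pose A : fm (ext D tyN) := Var (vs d) @ v0 ≐ 𝟎.
by apply: (rca (ax_ind (A := A) I)); split.
Qed.

(** The case distinction is made classically outside the model; for decidable conditions [def_ite]
    brings it inside. *)
Definition ite (P : Prop) s (a b : D s) : D s :=
  match excluded_middle_informative P with left _ => a | right _ => b end.

Lemma iteT (P : Prop) s (a b : D s) : P -> ite P a b = a.
Proof. by rewrite /ite; case: excluded_middle_informative. Qed.
Lemma iteF (P : Prop) s (a b : D s) : ~ P -> ite P a b = b.
Proof. by rewrite /ite; case: excluded_middle_informative. Qed.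

Definition decidable l (P : tele l -> Prop) : Prop :=
  exists2 F : tele l -> N, definable F & forall e, F e = 0 <-> P e.

(** Iterating the constant function with value [b] from [a] gives [a] after no step and [b] after
    any positive number of steps. *)
Lemma cond_exists : exists c : D (tyN ⟶ tyN ⟶ tyN ⟶ tyN),
  forall n a b, c · n · a · b = ite (n = 0) a b.
Proof.
have [h Hh] : definable (l := [tyN; tyN; tyN])
    (fun e => int_cst cR · (int_cst (cK tyN tyN) · snd e) · snd (fst e) · snd (fst (fst e))).
  apply: def_app; last exact: def_v2.
  apply: def_app; last exact: def_v1.
  apply: def_app; first exact: def_const.
  by apply: def_app; [apply: def_const|apply: def_v0].
exists h => n a b; apply: (eq_trans (Hh (tt, n, a, b))) => /=.
case: (zero_or_S n) => [->|[m ->]]; first by rewrite R0 iteT.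
by rewrite RS appK iteF //; apply: S_neq0.
Qed.

Lemma def_ite l (P : tele l -> Prop) (F G : tele l -> N) :
  decidable P -> definable F -> definable G -> definable (fun e => ite (P e) (F e) (G e)).
Proof.
move=> [C dC HC] dF dG; have [c Hc] := cond_exists.
apply: (def_ext (F := fun e => c · C e · F e · G e)).
  move=> e; rewrite Hc; case: (classic (P e)) => HP; first by rewrite !iteT ?HC.
  by rewrite !iteF ?HC.
by do 3 (apply: def_app => //); apply: def_const.
Qed.

Lemma dec_ext l (P Q : tele l -> Prop) : (forall e, P e <-> Q e) -> decidable P -> decidable Q.
Proof. by move=> E [F dF HF]; exists F => // e; rewrite HF. Qed.

Lemma dec_char l (P : tele l -> Prop) : decidable P -> definable (fun e => ite (P e) 0 1).
Proof. by move=> dP; apply: def_ite => //; apply: def_const. Qed.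

Lemma ite01 P : ite P 0 1 = 0 <-> P.
Proof.
case: (classic P) => HP; first by rewrite iteT.
by rewrite iteF //; split=> // /one_neq0.
Qed.

Lemma dec_not l (P : tele l -> Prop) : decidable P -> decidable (fun e => ~ P e).
Proof.
move=> dP; exists (fun e => ite (P e) 1 0); first by apply: def_ite => //; apply: def_const.
move=> e; case: (classic (P e)) => HP; first by rewrite iteT //; split=> // /one_neq0.
by rewrite iteF.
Qed.

Lemma dec_and l (P Q : tele l -> Prop) :
  decidable P -> decidable Q -> decidable (fun e => P e /\ Q e).
Proof.
move=> dP dQ; exists (fun e => ite (P e) (ite (Q e) 0 1) 1).
  by apply: def_ite => //; [apply: dec_char|apply: def_const].
move=> e; case: (classic (P e)) => HP; first by rewrite iteT // ite01; tauto.
by rewrite iteF //; split=> [/one_neq0|[]].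
Qed.

Lemma dec_imp l (P Q : tele l -> Prop) :
  decidable P -> decidable Q -> decidable (fun e => P e -> Q e).
Proof.
move=> dP dQ; apply: (dec_ext (P := fun e => ~ (P e /\ ~ Q e))).
  by move=> e; split=> [H HP|H [HP []]]; [apply: NNPP => HQ; apply: H|apply: H].
by apply/dec_not/dec_and/dec_not.
Qed.

Lemma dec_or l (P Q : tele l -> Prop) :
  decidable P -> decidable Q -> decidable (fun e => P e \/ Q e).
Proof.
move=> dP dQ; apply: (dec_ext (P := fun e => ~ P e -> Q e)).
  by move=> e; case: (classic (P e)); tauto.
by apply/dec_imp => //; apply/dec_not.
Qed.

(** The choice functional is applied to a function that carries the two numbers
    to be compared as its values at 0 and 1. *)
Lemma eq_char : exists E : D ty2, forall f, E · f = 0 <-> f · 0 = f · 1.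
Proof.
pose A : fm (ext (ext D ty1) tyN) :=
  (v1 @ 𝟎 ≐ v1 @ 𝟏 ⋏ v0 ≐ 𝟎) ⋎ (∼ (v1 @ 𝟎 ≐ v1 @ 𝟏) ⋏ v0 ≐ 𝟏).
have qA : qfree A by [].
have [f|E HE] := rca (ax_QFAC10 (QFAC_ax qA)).
  by case: (classic (f · 0 = f · 1)) => Hf; [exists 0; left|exists 1; right].
exists E => f; case: (HE f) => - [/= H1 H2]; first by split.
by split=> [|//] H0; case: one_neq0; rewrite -H0.
Qed.

Lemma lt_char : exists E : D ty2, forall f, E · f = 0 <-> f · 0 < f · 1.
Proof.
pose A : fm (ext (ext D ty1) tyN) :=
  (v1 @ 𝟎 ≺ v1 @ 𝟏 ⋏ v0 ≐ 𝟎) ⋎ (∼ (v1 @ 𝟎 ≺ v1 @ 𝟏) ⋏ v0 ≐ 𝟏).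
have qA : qfree A by [].
have [f|E HE] := rca (ax_QFAC10 (QFAC_ax qA)).
  by case: (classic (f · 0 < f · 1)) => Hf; [exists 0; left|exists 1; right].
exists E => f; case: (HE f) => - [/= H1 H2]; first by split.
by split=> [|//] H0; case: one_neq0; rewrite -H0.
Qed.

Lemma dec_rel (R : N -> N -> Prop) (E : D ty2) l (F G : tele l -> N) :
  (forall f, E · f = 0 <-> R (f · 0) (f · 1)) ->
  definable F -> definable G -> decidable (fun e => R (F e) (G e)).
Proof.
move=> HE dF dG; have [c Hc] := cond_exists.
have dL : definable (fun e => Lam (fun n => c · n · F e · G e)).
  apply: def_lam; apply: def_app; last exact: def_weak dG.
  apply: def_app; last exact: def_weak dF.
  by apply: def_app; [apply: def_const|apply: def_v0].
(* The sequence has the value [F e] at 0 and [G e] everywhere else. *)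
exists (fun e => E · Lam (fun n => c · n · F e · G e)).
  by apply: def_app => //; apply: def_const.
move=> e; have L n : Lam (fun n => c · n · F e · G e) · n = c · n · F e · G e.
  apply: (Lam_spec (B := fun n => c · n · F e · G e)).
  do 2 (apply: def_app; last exact: def_const).
  by apply: def_app; [apply: def_const|apply: def_v0].
by rewrite HE !L !Hc iteT // iteF //; apply: one_neq0.
Qed.

Lemma dec_eq l (F G : tele l -> N) :
  definable F -> definable G -> decidable (fun e => F e = G e).
Proof. by have [E HE] := eq_char; apply: (dec_rel (R := @eq N) HE). Qed.

Lemma dec_lt l (F G : tele l -> N) :
  definable F -> definable G -> decidable (fun e => F e < G e).
Proof. by have [E HE] := lt_char; apply: dec_rel HE. Qed.

Lemma ind (P : N -> Prop) : decidable (l := [tyN]) (fun e => P (snd e)) ->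
  P 0 -> (forall n, P n -> P (n + 1)) -> forall n, P n.
Proof.
move=> [F [f Hf] HF] H0 HS n.
have E m : f · m = 0 <-> P m by move: (HF (tt, m)); rewrite -Hf.
by apply/E; move: n; apply: ind0 => [|n]; rewrite !E //; apply: HS.
Qed.

Ltac dfn_more := idtac.

Ltac dfn :=
  cbv beta;
  lazymatch goal with
  | |- definable (fun _ => ?c) => exact (def_const _ c)
  | |- definable (fun e => snd e) => exact (def_v0 _ _)
  | |- definable snd => exact (def_v0 _ _)
  | |- definable (fun e => snd (fst e)) => exact (def_v1 _ _ _)
  | |- definable (fun e => snd (fst (fst e))) => exact (def_v2 _ _ _ _)
  | |- definable (fun e => snd (fst (fst (fst e)))) => exact (def_v3 _ _ _ _ _)
  | |- definable (fun e => snd (fst (fst (fst (fst e))))) => exact (def_v4 _ _ _ _ _ _)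
  | |- definable (fun e => app _ _) => apply def_app; dfn
  | |- definable (fun e => add _ _) => apply def_add; dfn
  | |- definable (fun e => pair _ _) => apply def_pair; dfn
  | |- definable (fun e => ite _ _ _) => apply def_ite; dfn
  | |- definable (fun e => Lam _) => apply def_lam; dfn
  | |- decidable (fun e => _ = _) => apply dec_eq; dfn
  | |- decidable (fun e => _ < _) => apply dec_lt; dfn
  | |- decidable (fun e => _ <= _) => apply dec_or; dfn
  | |- decidable (fun e => _ /\ _) => apply dec_and; dfn
  | |- decidable (fun e => _ \/ _) => apply dec_or; dfn
  | |- decidable (fun e => ~ _) => apply dec_not; dfn
  | |- _ => dfn_more
  end.

Ltac beta := rewrite Lam_spec; last by dfn.

Ltac dfn_more ::=
  lazymatch goal with
  | |- decidable (fun e => _ -> _) => apply dec_imp; dfn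
  | |- _ => idtac
  end.

(** [bmu · p · n] is the least zero of [p] below [n] if there is one, and [n] otherwise:
    the iteration stops at the first zero. *)
Definition bmu : D (ty1 ⟶ tyN ⟶ tyN) :=
  Lam (fun p : D ty1 => Lam (fun n =>
    int_cst cR · Lam (fun m => ite (p · m = 0) m (m + 1)) · 0 · n)).

Lemma bmu_spec (p : D ty1) (n : N) :
  (forall k, k < bmu · p · n -> p · k <> 0) /\
  (bmu · p · n = n \/ (bmu · p · n < n /\ p · (bmu · p · n) = 0)).
Proof.
pose u := fun n => bmu · p · n.
have Eu m : u m = int_cst cR · Lam (fun m => ite (p · m = 0) m (m + 1)) · 0 · m.
  by rewrite /u /bmu; do 2 beta.
have u0 : u 0 = 0 by rewrite Eu R0.
have uS m : u (m + 1) = ite (p · u m = 0) (u m) (u m + 1).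
  by rewrite !Eu RS; beta.
have below k m : k < u m -> p · k <> 0.
  apply: (ind (P := fun m => k < u m -> p · k <> 0)); first by rewrite /u; dfn.
    by rewrite u0 => /lt0.
  move=> {}m IH; rewrite uS; case: (classic (p · u m = 0)) => Hm; first by rewrite iteT.
  by rewrite iteF // => /ltS_le [/IH|->].
have stop m : u m = m \/ (u m < m /\ p · u m = 0).
  apply: (ind (P := fun m => u m = m \/ (u m < m /\ p · u m = 0))); first by rewrite /u; dfn.
    by left.
  move=> {}m [IH|[IH1 IH2]]; rewrite uS; last first.
    by right; rewrite iteT //; split=> //; apply: lt_trans (ltS _).
  case: (classic (p · u m = 0)) => Hm; last by left; rewrite iteF // IH.
  by right; rewrite iteT //; split=> //; rewrite {1}IH; apply: ltS.
by split=> [k|]; [apply: below|apply: stop].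
Qed.

(** The search [bmu] stays below the bound exactly when it succeeds. *)
Lemma dec_exlt l (P : tele l -> N -> Prop) (b : tele l -> N) :
  definable b -> decidable (l := tyN :: l) (fun e => P (fst e) (snd e)) ->
  decidable (fun e => exists k, k < b e /\ P e k).
Proof.
move=> db [F dF HF].
have dL : definable (fun e => Lam (fun k => F (e, k))).
  by apply: def_lam; apply: def_ext dF => - [].
have L e k : Lam (fun k => F (e, k)) · k = F (e, k).
  case: dL => f Hf; apply: (Lam_spec (B := fun k => F (e, k))).
  have [g Hg] := def_const nil (apps f e).
  have [c Hc] := dF.
  exists (apps (l := l) (t := tyN ⟶ tyN) c e) => - [? x] /=; exact: (Hc (e, x)).
have [G dG HG] : decidable (fun e => bmu · Lam (fun k => F (e, k)) · b e < b e).
  by apply: dec_lt => //; do 2 (apply: def_app => //); apply: def_const.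
exists G => // e; rewrite HG; have [H1 H2] := bmu_spec (Lam (fun k => F (e, k))) (b e).
split=> [H|[k [kb Pk]]].
  case: H2 => [E|[_ H0]]; first by move: H; rewrite E => /lt_irr.
  by exists (bmu · Lam (fun k => F (e, k)) · b e); split=> //; move: H0; rewrite L HF.
case: H2 => [E|[]] //; case: (H1 k); first by rewrite E.
by rewrite L HF.
Qed.

Ltac dfn_more ::=
  lazymatch goal with
  | |- decidable (fun e => exists k, k < _ /\ _) => apply dec_exlt; dfn
  | |- _ => idtac
  end.

Lemma dec_alllt l (P : tele l -> N -> Prop) (b : tele l -> N) :
  definable b -> decidable (l := tyN :: l) (fun e => P (fst e) (snd e)) ->
  decidable (fun e => forall k, k < b e -> P e k).
Proof.
move=> db dP; apply: (dec_ext (P := fun e => ~ exists k, k < b e /\ ~ P e k)).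
  move=> e; split=> [H k kb|H [k [kb]]]; last by case; apply: H.
  by apply: NNPP => nP; apply: H; exists k.
by apply/dec_not/dec_exlt => //; apply/dec_not.
Qed.

Ltac dfn_more ::=
  lazymatch goal with
  | |- decidable (fun e => exists k, k < _ /\ _) => apply dec_exlt; dfn
  | |- decidable (fun e => forall k, k < _ -> _) => apply dec_alllt; dfn
  | |- decidable (fun e => _ -> _) => apply dec_imp; dfn
  | |- _ => idtac
  end.

Lemma least (P : N -> Prop) : decidable (l := [tyN]) (fun e => P (snd e)) ->
  (exists n, P n) -> exists n, P n /\ forall k, k < n -> ~ P k.
Proof.
move=> dP [n Pn]; apply: NNPP => H.
have dQ : decidable (l := [tyN]) (fun e => forall k, k < snd e -> ~ P k).
  apply: (dec_alllt (P := fun (e : tele [tyN]) k => ~ P k)); first exact: def_v0.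
  apply: dec_not; case: dP => F [f Hf] HF.
  exists (fun e : tele [tyN; tyN] => f · snd e); first by dfn.
  by move=> e; move: (HF (tt, snd e)); rewrite -Hf.
have A : forall m k, k < m -> ~ P k.
  apply: (ind dQ) => [k /lt0 //|m IH k /ltS_le [/IH //|-> Pm]].
  by apply: H; exists m.
exact: A (ltS n) Pn.
Qed.

(** * Choice, pairing and sequence codes *)

Lemma choice0 s (MQ : forall A : fm D, QFAC s tyN A -> sat env_id A) (A : D s -> N -> Prop) :
  decidable (l := [tyN; s]) (fun e => A (snd (fst e)) (snd e)) ->
  (forall x, exists n, A x n) -> exists Y : D (s ⟶ tyN), forall x, A x (Y · x).
Proof.
move=> [F [f Hf] HF] HA.
(* The characteristic function enters as a parameter, so a decidable matrix becomes a
   quantifier-free equation. *)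
pose B : fm (ext (ext D s) tyN) := Var (vs (vs (f : D (s ⟶ tyN ⟶ tyN)))) @ v1 @ v0 ≐ 𝟎.
have E x n : f · x · n = 0 <-> A x n by move: (HF (tt, x, n)); rewrite -Hf.
have [x|Y HY] := MQ _ (QFAC_ax (A := B) I).
  by have [n /E Hn] := HA x; exists n.
by exists Y => x; apply/E/HY.
Qed.

Lemma choice1 (A : D ty1 -> N -> Prop) :
  decidable (l := [tyN; ty1]) (fun e => A (snd (fst e)) (snd e)) ->
  (forall x, exists n, A x n) -> exists Y : D ty2, forall x, A x (Y · x).
Proof. by apply: choice0 => B HB; apply/rca/ax_QFAC10. Qed.

Lemma choice2 (A : D ty2 -> N -> Prop) :
  decidable (l := [tyN; ty2]) (fun e => A (snd (fst e)) (snd e)) ->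
  (forall x, exists n, A x n) -> exists Y : D ty3, forall x, A x (Y · x).
Proof. by apply: choice0 => B HB; apply: MT; right. Qed.

Lemma choice (A : N -> N -> Prop) :
  decidable (l := [tyN; tyN]) (fun e => A (snd (fst e)) (snd e)) ->
  (forall x, exists n, A x n) -> exists Y : D ty1, forall x, A x (Y · x).
Proof.
move=> [F [f Hf] HF] HA.
have E x n : f · x · n = 0 <-> A x n by move: (HF (tt, x, n)); rewrite -Hf.
(* Choice over numbers is reduced to choice over type 1: a number is represented by a constant
   function and read off at 0. *)
have [|g|Y HY] := @choice1 (fun g n => f · (g · 0) · n = 0); first by dfn.
  by have [n /E Hn] := HA (g · 0); exists n.
exists (Lam (fun x => Y · (int_cst (cK tyN tyN) · x))) => x; beta.
by apply/E; move: (HY (int_cst (cK tyN tyN) · x)); rewrite appK.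
Qed.

(** Both components are at most the code, so bounded quantifiers describe the projection by a
    decidable condition, vacuous at numbers that are not codes, and choice applies. *)
Lemma fst_exists : exists p : D ty1, forall x y, p · pair x y = x.
Proof.
have [||p Hp] := @choice (fun p x => forall a, a < p + 1 -> forall b, b < p + 1 -> p = pair a b -> x = a).
- by dfn.
- move=> p; case: (classic (exists a b, p = pair a b)) => [[a [b ->]]|H].
    by exists a => a' _ b' _ /pair_inj [].
  by exists 0 => a _ b _ E; case: H; exists a, b.
- by exists p => x y; apply: (Hp (pair x y)); [apply: pair_ge1|apply: pair_ge2|].
Qed.

Lemma snd_exists : exists p : D ty1, forall x y, p · pair x y = y.
Proof.
have [||p Hp] := @choice (fun p x => forall a, a < p + 1 -> forall b, b < p + 1 -> p = pair a b -> x = b).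
- by dfn.
- move=> p; case: (classic (exists a b, p = pair a b)) => [[a [b ->]]|H].
    by exists b => a' _ b' _ /pair_inj [].
  by exists 0 => a _ b _ E; case: H; exists a, b.
- by exists p => x y; apply: (Hp (pair x y)) (pair_ge1 _ _) _ (pair_ge2 _ _) _.
Qed.

Lemma pred_exists : exists p : D ty1, forall x, p · (x + 1) = x.
Proof.
have [||p Hp] := @choice (fun x y => x = 0 \/ x = y + 1).
- by dfn.
- by move=> x; case: (zero_or_S x) => [->|[y ->]]; [exists 0; left|exists y; right].
- exists p => x; case: (Hp (x + 1)) => [/S_neq0 //|E].
by apply: (@add_inj _ _ 1); rewrite -E.
Qed.

Definition fst' : D ty1 := proj1_sig (constructive_indefinite_description _ fst_exists).
Definition snd' : D ty1 := proj1_sig (constructive_indefinite_description _ snd_exists).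
Definition pred' : D ty1 := proj1_sig (constructive_indefinite_description _ pred_exists).

Lemma fstP (x y : N) : fst' · pair x y = x.
Proof. by rewrite /fst'; case: constructive_indefinite_description => p /= ->. Qed.
Lemma sndP (x y : N) : snd' · pair x y = y.
Proof. by rewrite /snd'; case: constructive_indefinite_description => p /= ->. Qed.
Lemma predP (x : N) : pred' · (x + 1) = x.
Proof. by rewrite /pred'; case: constructive_indefinite_description => p /= ->. Qed.

(** [R_0] iterates a function that does not see the stage; iterating on pairs of a counter and a
    value gives recursion with a stage argument. *)
Definition Rec : D ((tyN ⟶ tyN ⟶ tyN) ⟶ tyN ⟶ tyN ⟶ tyN) :=
  Lam (fun g : D (tyN ⟶ tyN ⟶ tyN) => Lam (fun a => Lam (fun n =>
    snd' · (int_cst cR · Lam (fun p => pair (fst' · p + 1) (g · (fst' · p) · (snd' · p)))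
            · pair 0 a · n)))).

Lemma Rec_spec (g : D (tyN ⟶ tyN ⟶ tyN)) (a : N) : Rec · g · a · 0 = a /\
  forall n : N, Rec · g · a · (n + 1) = g · n · (Rec · g · a · n).
Proof.
pose r n := int_cst cR · Lam (fun p => pair (fst' · p + 1) (g · (fst' · p) · (snd' · p)))
  · pair 0 a · n.
have E n : Rec · g · a · n = snd' · r n.
  by rewrite /Rec; do 3 beta.
have rS n : r (n + 1) = pair (fst' · r n + 1) (g · (fst' · r n) · (snd' · r n)).
  by rewrite /r RS; beta.
have F n : fst' · r n = n.
  apply: (ind (P := fun n => fst' · r n = n)); first by rewrite /r; dfn.
    by rewrite /r R0 fstP.
  by move=> {}n IH; rewrite rS fstP IH.
split=> [|n]; first by rewrite E /r R0 sndP.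
by rewrite !E rS sndP F.
Qed.

(** The paper's [\overline{f}n]. *)
Definition bar : D (ty1 ⟶ tyN ⟶ tyN) :=
  Lam (fun f : D ty1 => Lam (fun n => Rec · Lam (fun k => Lam (fun s => pair s (f · k) + 1)) · 0 · n)).

Lemma bar0 (f : D ty1) : bar · f · 0 = 0.
Proof.
rewrite /bar; do 2 beta.
by have [-> _] := Rec_spec (Lam (fun k => Lam (fun s => pair s (f · k) + 1))) 0.
Qed.

Lemma barS (f : D ty1) (n : N) : bar · f · (n + 1) = pair (bar · f · n) (f · n) + 1.
Proof.
rewrite /bar; do 3 beta.
have [_ ->] := Rec_spec (Lam (fun k => Lam (fun s => pair s (f · k) + 1))) 0.
by do 2 beta.
Qed.

Lemma bar_inj (f g : D ty1) (m n : N) : m < n -> bar · f · n = bar · g · n -> f · m = g · m.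
Proof.
move=> mn E; apply: (ind (P := fun n => m < n -> bar · f · n = bar · g · n -> f · m = g · m) _ _ _ n mn E).
- by dfn.
- by move=> /lt0.
- move=> {E mn}n IH mn; rewrite !barS => /add_inj /pair_inj [E1 E2].
  by move: mn => /ltS_le [/IH|->]; auto.
Qed.

Lemma bar_eq (f g : D ty1) (n : N) :
  (forall k, k < n -> f · k = g · k) -> bar · f · n = bar · g · n.
Proof.
move=> E; suff H : forall m, m <= n -> bar · f · m = bar · g · m by apply/H/le_refl.
apply: ind; first by dfn.
  by rewrite !bar0.
move=> m IH mn; have lt_mn : m < n by apply: lt_le_trans (ltS _) mn.
by rewrite !barS E // IH //; apply: ltW.
Qed.

Lemma bar_mono (f : D ty1) (n m : N) : n <= m -> bar · f · n <= bar · f · m.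
Proof.
apply: (ind (P := fun m => n <= m -> bar · f · n <= bar · f · m)); first by dfn.
  by case=> [/lt0 //|->]; apply: le_refl.
move=> {}m IH [/ltS_le /IH H|->]; last exact: le_refl.
by apply: le_trans H _; left; rewrite barS; apply: pair_ge1.
Qed.

(** The formula [sat] makes of [initseg]. *)
Definition Initseg (f : D ty1) (n s : N) : Prop :=
  exists h : D ty1, h · 0 = 0 /\
    (forall k, k < n -> h · (k + 1) = pair (h · k) (f · k) + 1) /\ h · n = s.

Lemma InitsegE f n s : Initseg f n s <-> s = bar · f · n.
Proof.
split=> [[h [h0 [hS <-]]]|->]; last first.
  by exists (bar · f); rewrite bar0; split=> //; split=> // k _; rewrite barS.
suff H : forall m, m <= n -> h · m = bar · f · m by apply/H/le_refl.
apply: ind; first by dfn.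
  by rewrite bar0.
move=> m IH mn; have lt_mn : m < n by apply: lt_le_trans (ltS _) mn.
by rewrite barS hS // IH //; apply: ltW.
Qed.

Definition inC (f : D ty1) : Prop := forall k, f · k <= 1.

Lemma inC_sat (f : D ty1) :
  (forall k, f · k < int_cst (cK tyN tyN) · 1 · k \/ f · k = int_cst (cK tyN tyN) · 1 · k) <->
  inC f.
Proof. by split=> H k; move: (H k); rewrite appK. Qed.

Lemma ite_le1 (P : Prop) : ite P 0 1 <= 1 /\ ite P 1 0 <= 1.
Proof.
case: (classic P) => HP; rewrite ?(iteT _ _ HP) ?(iteF _ _ HP);
  split; [exact: le0x|exact: le_refl|exact: le_refl|exact: le0x].
Qed.

Lemma ite10 P : 0 < ite P 1 0 <-> P.
Proof.
rewrite pos_neq0; case: (classic P) => HP; first by rewrite iteT //; split=> // _; apply: one_neq0.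
by rewrite iteF.
Qed.

(** * The principles in a model *)

Definition E2_ (phi : D ty2) : Prop := forall f, (exists n, f · n = 0) <-> phi · f = 0.
Definition S2_ (S : D ty2) : Prop :=
  forall f, (exists g, forall n, f · (bar · g · n) = 0) <-> S · f = 0.
Definition E3_ (E : D ty3) : Prop := forall Y, (exists f, Y · f = 0) <-> E · Y = 0.
Definition kappa_ (K : D ty3) : Prop :=
  forall Y, K · Y = 0 <-> exists f, inC f /\ 0 < Y · f.
Definition MUC_ (Om : D ty3) : Prop := forall Y f g, inC f -> inC g ->
  bar · f · (Om · Y) = bar · g · (Om · Y) -> Y · f = Y · g.
Definition WKL_ : Prop := forall T : D ty1,
  (forall s, T · s = 0 -> exists f, inC f /\ exists n, s = bar · f · n) ->
  (forall f n m, m < n -> T · (bar · f · n) = 0 -> T · (bar · f · m) = 0) ->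
  (forall n, exists s, n < s /\ T · s = 0) ->
  exists f, inC f /\ forall n, T · (bar · f · n) = 0.

(** Only the zeros of the functionals matter in the principles, so truncating the values to 0 and 1
    meets the bound; [E2_], [S2_] and [E3_] therefore omit it. *)
Lemma leT_bounded s (phi : D (s ⟶ tyN)) :
  exists phi' : D (s ⟶ tyN), (forall f, phi' · f <= int_cst (cK tyN s) · 1 · f) /\
    forall f, phi' · f = 0 <-> phi · f = 0.
Proof.
exists (Lam (fun f => ite (phi · f = 0) 0 1)); split=> f; beta.
  by rewrite appK; apply: (proj1 (ite_le1 _)).
exact: ite01.
Qed.

Section Sat.
Variable V : ctx.
Variable e : env M V.

Lemma zero_at_segE (f g : D ty1) (n : N) :
  (exists s, Initseg g n s /\ f · s = 0) <-> f · (bar · g · n) = 0.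
Proof.
split=> [[s [/InitsegE -> //]]|H].
by exists (bar · g · n); split=> //; apply/InitsegE.
Qed.

Lemma sat_E2 : sat e E2 <-> exists phi, E2_ phi.
Proof.
split=> [[phi [_ H]]|[phi H]]; first by exists phi => f; apply: (H f).
have [phi' [B H']] := leT_bounded phi.
exists phi'; split; first exact: B.
by move=> f; move: (H f); rewrite -H'.
Qed.

Lemma sat_S2 : sat e S2 <-> exists S, S2_ S.
Proof.
have Z f : (exists g, forall n, f · (bar · g · n) = 0) <->
           (exists g, forall n, exists s, Initseg g n s /\ f · s = 0).
  by split=> - [g H]; exists g => n; apply/zero_at_segE.
split=> [[S [_ H]]|[S H]]; first by exists S => f; rewrite Z; apply: (H f).
have [S' [B H']] := leT_bounded S.
exists S'; split; first exact: B.
by move=> f; move: (H f); rewrite -H' Z.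
Qed.

Lemma sat_E3 : sat e E3 <-> exists E, E3_ E.
Proof.
split=> [[E [_ H]]|[E H]]; first by exists E => Y; apply: (H Y).
have [E' [B H']] := leT_bounded E.
exists E'; split; first exact: B.
by move=> Y; move: (H Y); rewrite -H'.
Qed.

Lemma sat_kappa03 : sat e kappa03 <-> exists K, kappa_ K.
Proof.
split=> - [K H]; exists K => Y.
  rewrite (H Y : K · Y = 0 <-> _); split=> - [f [Cf Hf]]; exists f; split=> //; exact/inC_sat.
split=> [/H [f [/inC_sat Cf Hf]]|[f [/inC_sat Cf Hf]]]; first by exists f.
by apply/H; exists f.
Qed.

Lemma eq_segE (f g : D ty1) (n : N) :
  (exists s, Initseg f n s /\ Initseg g n s) <-> bar · f · n = bar · g · n.
Proof.
split=> [[s [/InitsegE -> /InitsegE //]]|H].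
by exists (bar · f · n); split; apply/InitsegE.
Qed.

Lemma sat_MUC : sat e MUC <-> exists Om, MUC_ Om.
Proof.
split=> - [Om H]; exists Om => Y f.
  move=> g /inC_sat Cf /inC_sat Cg E; exact: (H Y f Cf g Cg (proj2 (eq_segE _ _ _) E)).
by move=> /inC_sat Cf g /inC_sat Cg E; apply: H => //; apply/(eq_segE f g (Om · Y)).
Qed.

Lemma sat_WKL : sat e WKL <-> WKL_.
Proof.
split=> H T.
  move=> H1 H2 H3; have [|f [/inC_sat Cf Hf]] := H T; last first.
    by exists f; split=> // n; apply/zero_at_segE; exact: (Hf n).
  split; last exact: H3.
  split=> [s /H1 [f [Cf [n E]]]|f n m [mn /zero_at_segE Hn]].
    by exists f; split; [apply/inC_sat|exists n; apply/InitsegE].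
  by apply/zero_at_segE; apply: H2 mn Hn.
move=> [[H1 H2] H3]; have [|||f [Cf Hf]] := H T.
- move=> s /H1 [f [/inC_sat Cf [n /InitsegE E]]].
  by exists f; split=> //; exists n.
- move=> f n m mn /zero_at_segE Hn; apply/zero_at_segE.
  by apply: (H2 f n m); split.
- exact: H3.
- by exists f; split; [apply/inC_sat|move=> n; apply/zero_at_segE].
Qed.

End Sat.

(** * Consequences of MUC *)

Section FromMUC.
Variable Om : D ty3.
Hypothesis HOm : MUC_ Om.

(** If [Y f] reached this bound, flipping [f] at the position [Y f] would change
    neither [Y f] nor [f (Y f)], by the choice of the two moduli. *)
Lemma MUC_bound (Y : D ty2) (f : D ty1) : inC f ->
  Y · f < Om · Y + Om · Lam (fun g => g · (Y · g)).
Proof.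
move=> Cf; set Y2 := Lam _; apply: NNPP => /not_lt HB.
have Y2E (g : D ty1) : Y2 · g = g · (Y · g) by rewrite /Y2; beta.
pose m := Y · f.
pose f' := Lam (fun k => ite (k = m) (ite (f · k = 0) 1 0) (f · k)).
have Ef' k : f' · k = ite (k = m) (ite (f · k = 0) 1 0) (f · k) by rewrite /f'; beta.
have Cf' : inC f'.
  move=> k; rewrite Ef'; case: (classic (k = m)) => Hk; last by rewrite iteF.
  by rewrite iteT //; apply: (proj2 (ite_le1 _)).
have agree n : n <= m -> bar · f · n = bar · f' · n.
  move=> nm; apply: bar_eq => k kn; rewrite Ef' iteF // => Ek.
  by apply: (lt_irr (x := m)); rewrite -{1}Ek; apply: lt_le_trans kn nm.
have E1 : Y · f = Y · f'.
  by apply: HOm Cf Cf' (agree _ _); apply: le_trans HB; apply: le_addr.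
have E2 : Y2 · f = Y2 · f'.
  by apply: HOm Cf Cf' (agree _ _); apply: le_trans HB; rewrite addC; apply: le_addr.
move: E2; rewrite !Y2E -E1 Ef' iteT //.
case: (classic (f · (Y · f) = 0)) => H0; first by rewrite iteT // H0 => /(@eq_sym _ _ _) /one_neq0.
by rewrite iteF.
Qed.

(** A retraction of Baire space onto [C]: through it, choice over all of type 1 serves statements
    about [C]. *)
Definition clamp : D (ty1 ⟶ ty1) := Lam (fun f : D ty1 => Lam (fun k => ite (f · k = 0) 0 1)).

Lemma clampE (f : D ty1) (k : N) : clamp · f · k = ite (f · k = 0) 0 1.
Proof. by rewrite /clamp; do 2 beta. Qed.

Lemma inC_clamp (f : D ty1) : inC (clamp · f).
Proof. by move=> k; rewrite clampE; apply: (proj1 (ite_le1 _)). Qed.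

Lemma clamp_id (f : D ty1) : inC f -> clamp · f = f.
Proof.
move=> Cf; apply: extM => k; rewrite clampE.
case/le1: (Cf k) => ->; first by rewrite iteT.
by rewrite iteF //; apply: one_neq0.
Qed.

(** Without a path, choice gives for each [f] a level [Y f] at which its retract has left the tree.
    A bound [B] for [Y] on [C] bounds the height, and a bound for the code of the segment of length
    [B] bounds all elements of the tree. *)
Lemma MUC_WKL : WKL_.
Proof.
move=> T H1 H2 H3; apply: NNPP => nP.
have [f|Y HY] := choice1 (A := fun f n => ~ T · (bar · (clamp · f) · n) = 0) ltac:(by dfn).
  apply: NNPP => nE; apply: nP; exists (clamp · f); split; first exact: inC_clamp.
  by move=> n; apply: NNPP => Hn; apply: nE; exists n.
set B := Om · Y + Om · Lam (fun g => g · (Y · g)).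
pose Z := Lam (fun g : D ty1 => bar · g · B).
have [s [Bs Ts]] := H3 (Om · Z + Om · Lam (fun g => g · (Z · g))).
have [g [Cg [n Es]]] := H1 s Ts; subst s.
(* The tree is closed under initial segments, so a node of length above [Y g] on [g] would put the
   segment of length [Y g] in the tree. *)
have nY : n <= Y · g.
  apply/not_lt => Yn; apply: (HY g); rewrite clamp_id //; exact: H2 Yn Ts.
apply: (lt_irr (x := bar · g · n)); apply: (le_lt_trans (y := bar · g · B)).
  by apply: bar_mono; apply: le_trans nY _; left; apply: MUC_bound.
by apply: lt_trans Bs; have := MUC_bound Z Cg; rewrite {1}/Z; beta.
Qed.

Lemma MUC_not_E2 phi : ~ E2_ phi.
Proof.
move=> Hphi; pose u := int_cst (cK tyN tyN) · 1.
(* The only zero of [g] is at the first position that the modulus of [phi] does not inspect, so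
   [phi] cannot tell [g] from the constant 1. *)
pose g := Lam (fun k => ite (k = Om · phi) 0 1).
have Eu k : u · k = 1 by rewrite /u appK.
have Eg k : g · k = ite (k = Om · phi) 0 1 by rewrite /g; beta.
have /Hphi Hg : exists n, g · n = 0 by exists (Om · phi); rewrite Eg iteT.
have [k Hk] : exists n, u · n = 0.
  apply/Hphi; rewrite -Hg; apply: HOm.
  - by move=> k; rewrite Eu; apply: le_refl.
  - by move=> k; rewrite Eg; apply: (proj1 (ite_le1 _)).
  - apply: bar_eq => k Hk; rewrite Eu Eg iteF // => E.
    by move: Hk; rewrite E => /lt_irr.
- by apply: one_neq0; rewrite -(Eu k).
Qed.

(** A dense sequence of [C]: [s] codes a finite binary sequence as a list built
    by [pair], and [snd'] removes its head. *)
Definition dense : D (tyN ⟶ ty1) :=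
  Lam (fun s => Lam (fun k => ite (fst' · (int_cst cR · snd' · s · k) = 0) 0 1)).

Lemma denseE (s k : N) : dense · s · k = ite (fst' · (int_cst cR · snd' · s · k) = 0) 0 1.
Proof. by rewrite /dense; do 2 beta. Qed.

Lemma inC_dense (s : N) : inC (dense · s).
Proof. by move=> k; rewrite denseE; apply: (proj1 (ite_le1 _)). Qed.

Lemma dense_spec (f : D ty1) (n : N) :
  exists s, bar · (dense · s) · n = bar · (clamp · f) · n.
Proof.
(* For [k <= n] the value [q · k] is the difference of [n] and [k]. *)
have [k|q Hq] := choice (A := fun k i => k <= n -> i + k = n) ltac:(by dfn).
  case: (classic (k <= n)) => [/le_ex [z Ez]|H]; last by exists 0.
  by exists z; rewrite addC.
(* The list is built from its end: for [j <= n], [a · j] lists the last [j] of the first [n] values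
   of [f], so [k] tails of [a · n] expose [f · k]. *)
pose g := Lam (fun j => Lam (fun t => pair (f · (q · (j + 1))) t)).
pose a := Rec · g · 0.
have aS j : a · (j + 1) = pair (f · (q · (j + 1))) (a · j).
  have [_ E] := Rec_spec g 0.
  by rewrite /a E {1}/g; do 2 beta.
have qS k : k + 1 <= n -> q · k = q · (k + 1) + 1.
  move=> kn; apply: (@add_inj _ _ k); rewrite Hq; last exact: le_trans (ltW (ltS _)) kn.
  by rewrite -(Hq _ kn); ring.
have tail k : k <= n -> int_cst cR · snd' · (a · n) · k = a · (q · k).
  apply: (ind (P := fun k => k <= n -> int_cst cR · snd' · (a · n) · k = a · (q · k))); first by dfn.
    by move=> _; rewrite R0 -{1}(Hq 0 (le0x n)) addx0.
  move=> {}k IH kn; rewrite RS IH; last exact: le_trans (ltW (ltS _)) kn.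
  by rewrite (qS k kn) aS sndP.
exists (a · n); apply: bar_eq => k /lt_le_S kn.
have kn' : k <= n by apply: le_trans (ltW (ltS _)) kn.
rewrite denseE clampE tail // (qS k kn) aS fstP -(qS k kn).
have -> // : q · (q · k) = k.
have qn : q · k <= n by rewrite -(Hq k kn'); apply: le_addr.
by apply: (@add_inj _ _ (q · k)); rewrite Hq // addC Hq.
Qed.

Lemma MUC_kappa : exists K, kappa_ K.
Proof.
pose tl := Lam (fun x : D ty1 => Lam (fun k => x · (k + 1))).
have tlE (x : D ty1) (k : N) : tl · x · k = x · (k + 1) by rewrite /tl; do 2 beta.
pose cons := Lam (fun n => Lam (fun f : D ty1 => Lam (fun k => ite (k = 0) n (f · (pred' · k))))).
have consE (n : N) (f : D ty1) (k : N) : cons · n · f · k = ite (k = 0) n (f · (pred' · k)).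
  by rewrite /cons; do 3 beta.
(* Choice takes one argument of type 1, so the length and the function are packed into [x]: its
   value at 0 is the length and its tail is the function. *)
have [x|c Hc] := choice1 (A := fun x s =>
    bar · (dense · s) · (x · 0) = bar · (clamp · (tl · x)) · (x · 0)) ltac:(by dfn).
  exact: dense_spec.
have index (n : N) (f : D ty1) : inC f ->
    bar · (dense · (c · (cons · n · f))) · n = bar · f · n.
  move=> Cf; have := Hc (cons · n · f); rewrite consE iteT //.
  have -> : tl · (cons · n · f) = f.
    by apply: extM => k; rewrite tlE consE iteF ?predP //; apply: S_neq0.
  by rewrite clamp_id.
pose Z := Lam (fun Y => Lam (fun f => c · (cons · (Om · Y) · f))).
have ZE (Y : D ty2) (f : D ty1) : Z · Y · f = c · (cons · (Om · Y) · f).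
  by rewrite /Z; do 2 beta.
(* [Z · Y] sends [f] to the index of an approximation up to the modulus of [Y]; being itself of type
   2, it is bounded on [C] by [MUC_bound]. *)
pose B Y := Om · (Z · Y) + Om · Lam (fun g => g · (Z · Y · g)).
exists (Lam (fun Y => ite (exists s, s < B Y /\ ~ Y · (dense · s) = 0) 0 1)) => Y.
rewrite Lam_spec; last by rewrite /B; dfn.
rewrite ite01; split=> [[s [_ Hs]]|[f [Cf /pos_neq0 Hf]]].
  by exists (dense · s); split; [apply: inC_dense|apply/pos_neq0].
exists (Z · Y · f); split; first exact: MUC_bound.
rewrite ZE (_ : Y · (dense · _) = Y · f) //.
by apply: HOm => //; [apply: inC_dense|apply: index].
Qed.

End FromMUC.

(** * Consequences of [kappa_0] *)

Section FromKappa.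
Variable K : D ty3.
Hypothesis HK : kappa_ K.

(** Two points of [C] are packed into one, so that [kappa_0] can search over pairs. *)
Definition lpart : D (ty1 ⟶ ty1) := Lam (fun p : D ty1 => Lam (fun k => p · pair 0 k)).
Definition rpart : D (ty1 ⟶ ty1) := Lam (fun p : D ty1 => Lam (fun k => p · pair 1 k)).

Lemma lpartE (p : D ty1) (k : N) : lpart · p · k = p · pair 0 k.
Proof. by rewrite /lpart; do 2 beta. Qed.
Lemma rpartE (p : D ty1) (k : N) : rpart · p · k = p · pair 1 k.
Proof. by rewrite /rpart; do 2 beta. Qed.

Lemma join_exists (f g : D ty1) : inC f -> inC g ->
  exists p, inC p /\ lpart · p = f /\ rpart · p = g.
Proof.
move=> Cf Cg.
pose p := Lam (fun n => ite (fst' · n = 0) (f · (snd' · n)) (g · (snd' · n))).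
have pE n : p · n = ite (fst' · n = 0) (f · (snd' · n)) (g · (snd' · n)) by rewrite /p; beta.
exists p; split; last split.
- move=> n; rewrite pE; case: (classic (fst' · n = 0)) => H; first by rewrite iteT.
  by rewrite iteF.
- by apply: extM => k; rewrite lpartE pE fstP sndP iteT.
- by apply: extM => k; rewrite rpartE pE fstP sndP iteF //; apply: one_neq0.
Qed.

Lemma inC_lpart (p : D ty1) : inC p -> inC (lpart · p).
Proof. by move=> Cp k; rewrite lpartE. Qed.
Lemma inC_rpart (p : D ty1) : inC p -> inC (rpart · p).
Proof. by move=> Cp k; rewrite rpartE. Qed.

(** A functional [Y] without modulus yields, for every [k], a pair of points of
    [C] that [Y] separates although they first differ after [k]; hence
    [exists k, x k = 0] becomes a question about some element of [C]. *)
Lemma kappa_modulus (Y : D ty2) : ~ (exists phi, E2_ phi) ->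
  exists n, forall f g, inC f -> inC g -> bar · f · n = bar · g · n -> Y · f = Y · g.
Proof.
move=> nE2; apply: NNPP => nM; apply: nE2.
(* By extensionality, halves separated by [Y] differ somewhere; [d · p] is such a position, with no
   constraint when they are not separated. *)
have [p|d Hd] := choice1 (A := fun p n =>
    ~ Y · (lpart · p) = Y · (rpart · p) -> ~ lpart · p · n = rpart · p · n) ltac:(by dfn).
  case: (classic (exists n, lpart · p · n <> rpart · p · n)) => [[n Hn]|H]; first by exists n.
  exists 0 => HY; case: HY; congr (_ · _); apply: extM => n.
  by apply: NNPP => Hn; apply: H; exists n.
exists (Lam (fun x : D ty1 => K · Lam (fun p =>
  ite (~ Y · (lpart · p) = Y · (rpart · p) /\ exists k, k < d · p + 1 /\ x · k = 0) 1 0))) => x.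
rewrite Lam_spec; last by dfn.
rewrite (HK _ : _ = 0 <-> _); split=> [[k Hk]|[p [_]]]; last first.
  by beta; move=> /ite10 [_ [k [_ Hk]]]; exists k.
have [f [g [Cf [Cg [E HY]]]]] : exists f g, inC f /\ inC g /\
    bar · f · k = bar · g · k /\ Y · f <> Y · g.
  apply: NNPP => H; apply: nM; exists k => f g Cf Cg E.
  by apply: NNPP => HY; apply: H; exists f, g.
have [p [Cp [Ef Eg]]] := join_exists Cf Cg.
exists p; split=> //; beta; apply/ite10.
(* The halves agree below [k], so the position [d · p] of a difference is at least [k]. *)
rewrite Ef Eg; split=> //; exists k; split=> //; apply/ltS_le/not_lt => lt_k.
by apply: (Hd p); rewrite Ef Eg //; apply: bar_inj lt_k E.
Qed.

(** [W Y n] detects counterexamples to [n] being a modulus of [Y]. With [kappa_0] their absence is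
    decidable, so choice for type 2 arguments collects the moduli. *)
Lemma kappa_MUC : ~ (exists phi, E2_ phi) -> exists Om, MUC_ Om.
Proof.
move=> nE2.
pose W (Y : D ty2) n := Lam (fun p =>
  ite (bar · (lpart · p) · n = bar · (rpart · p) · n /\ ~ Y · (lpart · p) = Y · (rpart · p)) 1 0).
have WE Y n p : 0 < W Y n · p <->
    bar · (lpart · p) · n = bar · (rpart · p) · n /\ Y · (lpart · p) <> Y · (rpart · p).
  by rewrite /W; beta; rewrite ite10.
have [Y|Om HOm] := choice2 (A := fun Y n => ~ K · W Y n = 0) ltac:(rewrite /W; by dfn).
  have [n Hn] := kappa_modulus Y nE2.
  exists n => /HK [p [Cp /WE [E []]]].
  by apply: Hn E; [apply: inC_lpart|apply: inC_rpart].
exists Om => Y f g Cf Cg E; apply: NNPP => HY; apply: (HOm Y); apply/HK.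
have [p [Cp [Ef Eg]]] := join_exists Cf Cg.
by exists p; split=> //; apply/WE; rewrite Ef Eg.
Qed.

Lemma kappa_E2_E3 phi : E2_ phi -> exists E, E3_ E.
Proof.
move=> Hphi.
(* [mu] is a search operator: it returns a zero of [f] whenever there is one. *)
have [f|mu Hmu] := choice1 (A := fun f n => phi · f = 0 -> f · n = 0) ltac:(by dfn).
  by case: (classic (phi · f = 0)) => [/Hphi [n Hn]|H]; [exists n|exists 0].
pose h (g : D ty1) n := Lam (fun m => ite (g · pair n m = 0) 1 0).
(* [fn] decodes a binary [g] as the graph of a function, finding by [mu] a column where row [n] is
   nonzero; [h] exchanges zero and nonzero to suit [mu]. *)
pose fn := Lam (fun g : D ty1 => Lam (fun n => mu · Lam (fun m => ite (g · pair n m = 0) 1 0))).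
have fnE g n : fn · g · n = mu · h g n by rewrite /fn /h; do 2 beta.
exists (Lam (fun Y : D ty2 => K · Lam (fun g => ite (Y · (fn · g) = 0) 1 0))) => Y.
rewrite Lam_spec; last by dfn.
rewrite (HK _ : _ = 0 <-> _); split=> [[f Hf]|[g [_]]]; last first.
  by beta; move=> /ite10 Hg; exists (fn · g).
pose g := Lam (fun p => ite (f · (fst' · p) = snd' · p) 1 0).
have gE p : g · p = ite (f · (fst' · p) = snd' · p) 1 0 by rewrite /g; beta.
exists g; split; first by move=> k; rewrite gE; apply: (proj2 (ite_le1 _)).
beta; apply/ite10; rewrite (_ : fn · g = f) //.
apply: extM => n; rewrite fnE.
have hE m : h g n · m = 0 <-> f · n = m.
  rewrite /h; beta; rewrite gE fstP sndP.
  case: (classic (f · n = m)) => E; first by rewrite (iteT _ _ E) iteF; [split|apply: one_neq0].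
  by rewrite (iteF _ _ E) iteT //; split=> // /one_neq0.
by apply/eq_sym/hE/Hmu/Hphi; exists (f · n); apply/hE.
Qed.

End FromKappa.

(** * Implications between the existence principles *)

Lemma E3_E2 E : E3_ E -> exists phi, E2_ phi.
Proof.
move=> HE; exists (Lam (fun f : D ty1 => E · Lam (fun g : D ty1 => f · (g · 0)))) => f.
beta; rewrite -HE; split=> [[n Hn]|[g]]; last by beta; exists (g · 0).
by exists (int_cst (cK tyN tyN) · n); beta; rewrite appK.
Qed.

(** The number quantifier along the path is decided by [phi], obtained from [E]; the remaining
    quantifier over paths is then of the form [E] decides. *)
Lemma E3_S2 E : E3_ E -> exists S, S2_ S.
Proof.
move=> HE; have [phi Hphi] := E3_E2 HE.
exists (Lam (fun f : D ty1 => E · Lam (fun g =>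
  ite (phi · Lam (fun n => ite (f · (bar · g · n) = 0) 1 0) = 0) 1 0))) => f.
beta; rewrite -HE.
have H g : Lam (fun g => ite (phi · Lam (fun n => ite (f · (bar · g · n) = 0) 1 0) = 0) 1 0) · g = 0
    <-> forall n, f · (bar · g · n) = 0.
  have i10 P : ite P 1 0 = 0 <-> ~ P.
    case: (classic P) => HP; first by rewrite iteT //; split=> // /one_neq0.
    by rewrite iteF.
  beta; rewrite i10 -Hphi; split=> [nE n|Hn [n]]; last by beta; rewrite i10.
  by apply: NNPP => Hn; apply: nE; exists n; beta; rewrite i10.
by split=> - [g Hg]; exists g; apply/H.
Qed.

(** The tree [t f] holds the empty sequence and the sequences whose last entry is a zero of [f]; a
    zero gives a constant path, and the first entry of a path is a zero. *)
Lemma S2_E2 S : S2_ S -> exists phi, E2_ phi.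
Proof.
move=> HS; pose t (f : D ty1) := Lam (fun s => ite (s = 0 \/ f · (snd' · (pred' · s)) = 0) 0 1).
exists (Lam (fun f : D ty1 => S · t f)) => f.
rewrite Lam_spec; last by rewrite /t; dfn.
have tE s : t f · s = 0 <-> s = 0 \/ f · (snd' · (pred' · s)) = 0.
  by rewrite /t; beta; rewrite ite01.
rewrite -HS; split=> [[m Hm]|[g Hg]].
  exists (int_cst (cK tyN tyN) · m) => n; apply/tE.
  case: (zero_or_S n) => [->|[k ->]]; first by left; rewrite bar0.
  by right; rewrite barS predP sndP appK.
exists (g · 0); move: (Hg (0 + 1)) => /tE; rewrite barS predP sndP.
by case=> // /S_neq0.
Qed.

Lemma principles_equivalent :
  let muc := exists Om, MUC_ Om in let kap := exists K, kappa_ K in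
  let e2 := exists phi, E2_ phi in let s2 := exists S, S2_ S in let e3 := exists E, E3_ E in
  (muc <-> kap /\ WKL_ /\ ~ e2) /\
  (kap /\ WKL_ /\ ~ e2 <-> kap /\ WKL_ /\ ~ s2) /\
  (kap /\ WKL_ /\ ~ s2 <-> kap /\ WKL_ /\ ~ e3).
Proof.
move=> muc kap e2 s2 e3.
have H32 : e3 -> s2 by move=> [E /E3_S2].
have H21 : s2 -> e2 by move=> [S /S2_E2].
have H13 : kap -> e2 -> e3 by move=> [K HK] [phi /(kappa_E2_E3 HK)].
have H1 : muc -> kap /\ WKL_ /\ ~ e2.
  move=> [Om HOm]; split; first exact: MUC_kappa HOm.
  by split; [apply: MUC_WKL HOm|move=> [phi /(MUC_not_E2 HOm)]].
have H2 : kap -> ~ e2 -> muc by move=> [K HK]; apply: kappa_MUC HK.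
tauto.
Qed.

End Model.

Theorem theorem3p3 :
  proves (extend RCA0w (QFAC ty2 tyN))
    ((MUC ⇔ kappa03 ⋏ WKL ⋏ ∼ E2)
     ⋏ (kappa03 ⋏ WKL ⋏ ∼ E2 ⇔ kappa03 ⋏ WKL ⋏ ∼ S2)
     ⋏ (kappa03 ⋏ WKL ⋏ ∼ S2 ⇔ kappa03 ⋏ WKL ⋏ ∼ E3)).
Proof.
apply: completeness.
- by apply: extend_subst; [apply: RCA0w_subst|apply: QFAC_subst].
- by move=> *; left; apply: ax_ext.
- move=> M extM MT; cbn [sat].
rewrite (sat_MUC extM MT) (sat_kappa03 extM MT) (sat_WKL extM MT).
rewrite (sat_E2 extM MT) (sat_S2 extM MT) (sat_E3 extM MT).
exact: principles_equivalent extM MT.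
Qed.
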